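(* Let $G$ be a compact connected metric graph of total length $L$, and let $\{\psi_j\}_{j\ge 1}$ be an orthonormal basis of $L^2(G)$ of real-valued eigenfunctions of the Kirchhoff-Neumann Laplacian $-\Delta$ on $G$, ordered so that the corresponding eigenvalues satisfy $0=\lambda_1<\lambda_2\le\lambda_3\le\cdots$. For every point $q\in G$, $$\lim_{N\to\infty}\frac1N\sum_{j=1}^N\psi_j(q)^2=\frac{2}{d_qL},$$ where $d_q$ is the degree of $q$ if $q$ is a vertex, and $d_q:=2$ if $q$ is an interior point of an edge.
   Context: A compact metric graph $G$ consists of finitely many vertices and finitely many edges, each edge identified with an interval of finite positive length; loops and multiple edges are allowed, and a loop contributes $2$ to the degree of its vertex. $L$ is the sum of the edge lengths. The Kirchhoff-Neumann Laplacian $-\Delta$ is the self-adjoint operator on $L^2(G)$ associated to the quadratic form $\|u'\|^2$ with domain $H^1(G)$ (functions that are $H^1$ on each edge and continuous on $G$). It acts as $-d^2/dx^2$ on each edge, on functions that are continuous on $G$ and whose outward derivatives (from the vertex into the incident edge-ends) sum to zero at each vertex. *)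

(* Defs.v *)
From HB Require Import structures.
From mathcomp Require Import all_boot all_order all_algebra.
From mathcomp Require Import all_classical all_reals all_analysis.
Import Order.TTheory GRing.Theory Num.Theory.
Import numFieldNormedType.Exports.

Set Implicit Arguments.
Unset Strict Implicit.
Unset Printing Implicit Defensive.

Local Open Scope classical_set_scope.
Local Open Scope ring_scope.

(* The edge [e] is the interval [0, len e], glued at [0] to [src e] and at
   [len e] to [tgt e]; the orientation is only a choice of coordinate. Loops
   and multiple edges are allowed. *)
Record metricGraph (R : realType) := MetricGraph {
  vertex : finType;
  edge : finType;
  src : edge -> vertex;
  tgt : edge -> vertex;
  len : edge -> R;
  len_gt0 : forall e, 0 < len e }.

Definition adjacent (R : realType) (G : metricGraph R) : rel (vertex G) :=
  fun v w => [exists e : edge G, ((src e == v) && (tgt e == w))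
                              || ((src e == w) && (tgt e == v))].

Definition connected_graph (R : realType) (G : metricGraph R) : Prop :=
  forall v w : vertex G, connect (@adjacent R G) v w.

Definition total_length (R : realType) (G : metricGraph R) : R :=
  \sum_(e : edge G) len e.

Definition vertex_degree (R : realType) (G : metricGraph R) (v : vertex G) :
  nat := (#|[set e : edge G | src e == v]%SET|
        + #|[set e : edge G | tgt e == v]%SET|)%N.

Inductive gpoint (R : realType) (G : metricGraph R) : Type :=
| Vertex of vertex G
| Interior (e : edge G) of {x : R | 0 < x < len e}.

Definition degree (R : realType) (G : metricGraph R) (q : gpoint G) : nat :=
  match q with
  | Vertex v => vertex_degree v
  | Interior _ _ => 2
  end.

(* The parametrization [0, len e] -> G of the closed edge [e], extended to the
   whole line by constants. *)
Definition edge_point (R : realType) (G : metricGraph R) (e : edge G) (x : R) :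
  gpoint G :=
  if x <= 0 then Vertex (src e)
  else if insub x is Some y then @Interior R G e y else Vertex (tgt e).

(* Data given edge by edge, with no compatibility at the vertices: only the
   values on [0, len e] matter. *)
Definition edge_family (R : realType) (G : metricGraph R) := edge G -> R -> R.

Definition on_edges (R : realType) (G : metricGraph R) (u : gpoint G -> R) :
  edge_family G := fun e x => u (edge_point e x).

Definition in_L2 (R : realType) (G : metricGraph R) (f : edge_family G) :
  Prop :=
  forall e, (f e \_ `[0, len e]) \in Lfun (@lebesgue_measure R) 2%:E.

Definition inner (R : realType) (G : metricGraph R) (f g : edge_family G) :
  R :=
  \sum_(e : edge G)
    (\int[@lebesgue_measure R]_(x in `[0%R, len e]) (f e x * g e x))%R.

Definition norm2 (R : realType) (G : metricGraph R) (f : edge_family G) : R :=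
  Num.sqrt (inner f f).

(* [u] belongs to H^1(G) and [du] is its (almost everywhere defined) edgewise
   derivative, in the coordinate of each edge: on each closed edge, [u] is the
   primitive of a square-integrable function. Since [u] is a function on the
   points of G, its values at the ends of the edges meeting at a vertex agree,
   so such a [u] is continuous on G. *)
Definition H1_deriv (R : realType) (G : metricGraph R)
    (u : gpoint G -> R) (du : edge_family G) : Prop :=
  in_L2 du /\
  forall (e : edge G) (x : R), 0 <= x <= len e ->
    on_edges u e x = on_edges u e 0
      + (\int[@lebesgue_measure R]_(t in `[0%R, x]) du e t)%R.

(* [u] is in the domain of the operator -Delta associated with the form
   ||u'||^2 on H^1(G), and -Delta u = f. *)
Definition neg_laplacian (R : realType) (G : metricGraph R)
    (u f : gpoint G -> R) : Prop :=
  in_L2 (on_edges f) /\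
  exists2 du : edge_family G, H1_deriv u du &
    forall (v : gpoint G -> R) (dv : edge_family G), H1_deriv v dv ->
      inner du dv = inner (on_edges f) (on_edges v).

Definition eigenfunction (R : realType) (G : metricGraph R)
    (lambda : R) (u : gpoint G -> R) : Prop :=
  norm2 (on_edges u) != 0 /\ neg_laplacian u (fun p => lambda * u p).

Definition orthonormal_basis (R : realType) (G : metricGraph R)
    (psi : nat -> gpoint G -> R) : Prop :=
  [/\ forall j, in_L2 (on_edges (psi j)),
      forall i j, inner (on_edges (psi i)) (on_edges (psi j)) = (i == j)%:R &
      forall f : gpoint G -> R, in_L2 (on_edges f) ->
        (fun N : nat => norm2 (on_edges (fun p => f p
          - \sum_(j < N) inner (on_edges f) (on_edges (psi j)) * psi j p)))
        @ \oo --> (0 : R)].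

(* Main.v *)
Require Import Defs.
From HB Require Import structures.
From mathcomp Require Import all_boot all_order all_algebra.
From mathcomp Require Import all_classical all_reals all_analysis.
From mathcomp Require Import measurable_realfun ring lra.
Import Order.TTheory GRing.Theory Num.Theory.
Import numFieldNormedType.Exports.

Local Open Scope classical_set_scope.
Local Open Scope ring_scope.

(* Write [k_j] for the square root of the j-th eigenvalue and [d] for the degree
   of [q].  Near [q], the sum of an eigenfunction [psi_j] over the [d] directions
   at distance [t] is [d psi_j(q) cos(k_j t)], so its inner product with the
   indicator of the ball of radius [t] is [d psi_j(q) sin(k_j t) / k_j].
   Parseval's identity for that indicator then reads, for all small [t],
     sum_j d psi_j(q)^2 (sin(k_j t) / (k_j t))^2 = 1 / t,
   whose right-hand side does not depend on [q].  Multiplying the kernel by a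
   polynomial in [sin^2] keeps the left-hand side a combination of such sums,
   so a Karamata type argument shows that the partial sums of [d psi_j(q)^2]
   and of [2 psi_j(x)^2], for [x] inside an edge, differ by [o(k_N)], uniformly
   for [x] away from the vertices.  Integrating over [x] gives
   [d L sum_(j < N) psi_j(q)^2 - 2 N = o(k_N)], and [k_N = O(N)]. *)

(** * Tauberian comparison of sampled weights *)

(** The balls are usable only below a fixed radius, so the Parseval identity is known only for small
    [t]: no Laplace transform over all times is available. What rescues the Karamata argument is
    that [sin x ^ 2] times a polynomial in [sin x ^ 2] is a combination of squares of [sin (i x)],
    so sampling at finitely many times [i t] suffices. The price is periodicity: [sin x ^ 2] is
    small again near every multiple of pi, and only the decay of [sinc2] controls those windows.
    Cutting at [x <= d] with [d] small makes them negligible against the main window.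

    The constant [J] produced in this way is never evaluated. It is the same for all weights whose
    sampled sums tend to [1 / t], so two points are compared with each other, and the normalisation
    comes from orthonormality alone.

    Neither second derivatives nor the vertex condition are extracted from the weak equation. It is
    only tested on tents about [q], which yields the cosine law at vertices and interior points
    alike. *)

Fixpoint bernstein {R : realType} (n : nat) (g : nat -> R) : {poly R} :=
  if n is m.+1 then (1 - 'X) * bernstein m g + 'X * bernstein m (g \o S)
  else (g 0%N)%:P.

(* The parabola is preserved by the recursion: its coefficient picks up the
   variance [x (1 - x)] of one Bernoulli trial at each step. *)
Lemma bernstein_le {R : realType} (n : nat) (g : nat -> R) (x y c al be : R) :
  0 <= x <= 1 ->
  (forall i : nat, `|g i - c| <= al + be * (i%:R - y) ^+ 2) ->
  `|(bernstein n g).[x] - c|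
     <= al + be * (n%:R * (x * (1 - x)) + (n%:R * x - y) ^+ 2).
Proof.
move=> x01; elim: n g y => [|n IH] g y hg /=.
  rewrite hornerC; apply: le_trans (hg 0%N) _; rewrite le_eqVlt; apply/orP; left.
  by apply/eqP; ring.
have -> : ((1 - 'X) * bernstein n g + 'X * bernstein n (g \o S)).[x]
  = (1 - x) * (bernstein n g).[x] + x * (bernstein n (g \o S)).[x].
  by rewrite !hornerE.
have h1 := IH g y hg.
have h2 : `|(bernstein n (g \o S)).[x] - c|
     <= al + be * (n%:R * (x * (1 - x)) + (n%:R * x - (y - 1)) ^+ 2).
  apply: IH => i /=; apply: le_trans (hg i.+1) _.
  by rewrite -natr1 le_eqVlt; apply/orP; left; apply/eqP; ring.
set A := (bernstein n g).[x] in h1 *.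
set B := (bernstein n (g \o S)).[x] in h2 *.
have -> : (1 - x) * A + x * B - c = (1 - x) * (A - c) + x * (B - c) by ring.
apply: le_trans (ler_normD _ _) _; rewrite !normrM.
have [x0 x1] := andP x01.
rewrite (ger0_norm x0) (ger0_norm (_ : 0 <= 1 - x)) ?subr_ge0//.
have := lerD (ler_wpM2l (_ : 0 <= 1 - x) h1) (ler_wpM2l x0 h2).
rewrite subr_ge0 => /(_ x1) /le_trans; apply; rewrite le_eqVlt; apply/orP; left.
apply/eqP; have -> : n.+1%:R = n%:R + 1 :> R by rewrite natr1.
by ring.
Qed.

Lemma lipschitz_poly_approx {R : realType} (f : R -> R) (L eta : R) :
  0 < L -> 0 < eta -> (forall x y, `|f x - f y| <= L * `|x - y|) ->
  exists P : {poly R}, forall x, 0 <= x <= 1 -> `|P.[x] - f x| <= eta.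
Proof.
move=> L0 eta0 hf.
pose d := eta / (2 * L); have d0 : 0 < d by rewrite divr_gt0// mulr_gt0.
have dE : L * d / 2 = eta / 4 by rewrite /d; field; rewrite !gt_eqF.
clearbody d.
have [n n0] : exists n : nat, L / (2 * d * eta) < n.+1%:R.
  exists (Num.truncn (L / (2 * d * eta))); exact: truncnS_gt.
set m : R := n.+1%:R in n0; have m0 : 0 < m by rewrite ltr0Sn.
exists (bernstein n.+1 (fun i => f (i%:R / m))) => x x01.
(* The Lipschitz bound is put in the parabolic form of [bernstein_le] by
   [|z| <= d / 2 + z ^ 2 / (2 d)]. The choice of [d] makes the constant part [eta / 4], and that of
   [n] keeps the variance part below [eta / 4] as well. *)
have hg i : `|f (i%:R / m) - f x|
    <= L * d / 2 + (L / (2 * d * m ^+ 2)) * (i%:R - m * x) ^+ 2.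
  apply: le_trans (hf _ _) _.
  set z := i%:R / m - x.
  have -> : i%:R - m * x = m * z by rewrite /z; field; rewrite gt_eqF.
  have -> : L * d / 2 + L / (2 * d * m ^+ 2) * (m * z) ^+ 2
     = L * (`|z| + (d - `|z|) ^+ 2 / (2 * d)).
    have -> : (d - `|z|) ^+ 2 = d ^+ 2 - 2 * d * `|z| + z ^+ 2.
      by rewrite sqrrB real_normK ?num_real//; ring.
    by field; rewrite !gt_eqF.
  rewrite ler_pM2l// lerDl divr_ge0 ?sqr_ge0// ltW// mulr_gt0//.
have := bernstein_le n.+1 _ _ _ _ _ _ x01 hg.
move=> /le_trans; apply; rewrite -/m subrr expr0n/= addr0.
have -> : L / (2 * d * m ^+ 2) * (m * (x * (1 - x)))
    = L / (2 * d * m) * (x * (1 - x)) by field; rewrite !gt_eqF.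
rewrite dE; have h1 : L / (2 * d * m) <= eta.
  rewrite ler_pdivrMr ?mulr_gt0//.
  move: n0; rewrite ltr_pdivrMr ?mulr_gt0// => /ltW/le_trans; apply.
  by rewrite le_eqVlt; apply/orP; left; apply/eqP; ring.
have h2 : 0 <= L / (2 * d * m) by rewrite divr_ge0 ?ltW ?mulr_gt0.
have h3 : x * (1 - x) <= 1 / 4.
  rewrite -subr_ge0; have -> : 1 / 4 - x * (1 - x) = (x - 1 / 2) ^+ 2 by field.
  exact: sqr_ge0.
have h4 : 0 <= x * (1 - x) by move/andP: x01 => [? ?]; rewrite mulr_ge0// subr_ge0.
have := ler_pM h2 h4 h1 h3; set w := _ * _ => h5.
by clearbody w; lra.
Qed.

(** * The kernel [sinc2] and its products with polynomials in [sin ^ 2] *)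

Definition sinc2 {R : realType} (x : R) : R :=
  if x == 0 then 1 else (sin x / x) ^+ 2.

Lemma sinc2_sqr {R : realType} (x : R) : x ^+ 2 * sinc2 x = sin x ^+ 2.
Proof.
rewrite /sinc2; case: eqP => [->|/eqP x0]; first by rewrite sin0 expr0n mul0r.
by field.
Qed.

Lemma sinc2_ge0 {R : realType} (x : R) : 0 <= sinc2 x.
Proof. by rewrite /sinc2; case: ifP => // _; exact: sqr_ge0. Qed.

Lemma sin2_mul {R : realType} (x y : R) :
  sin y ^+ 2 * sin x ^+ 2 = 2^-1 * sin y ^+ 2 + 2^-1 * sin x ^+ 2
    - 4^-1 * sin (y + x) ^+ 2 - 4^-1 * sin (y - x) ^+ 2.
Proof.
rewrite sinD sinB.
have -> : 2^-1 * sin y ^+ 2 + 2^-1 * sin x ^+ 2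
  - 4^-1 * (sin y * cos x + cos y * sin x) ^+ 2
  - 4^-1 * (sin y * cos x - cos y * sin x) ^+ 2
  = 2^-1 * (sin y ^+ 2 + sin x ^+ 2 - sin y ^+ 2 * cos x ^+ 2
     - cos y ^+ 2 * sin x ^+ 2) by field.
by rewrite !cos2sin2; field.
Qed.

Definition sin2_comb {R : realType} (s : seq (R * nat)) (x : R) : R :=
  \sum_(p <- s) p.1 * sin (p.2%:R * x) ^+ 2.

(** The sum of [b i ^ 2] is the coefficient of [x ^ 2] at the origin; it vanishes here because the
    product has a zero of order four. *)
Lemma sin2_comb_mul {R : realType} (s : seq (R * nat)) :
  exists s' : seq (R * nat),
    (forall x, sin2_comb s x * sin x ^+ 2 = sin2_comb s' x) /\
    \sum_(p <- s') p.1 * p.2%:R ^+ 2 = 0.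
Proof.
rewrite /sin2_comb; elim: s => [|[b i] s [s' [IH1 IH2]]].
  by exists [::]; split => [x|]; rewrite !big_nil ?mul0r.
(* [i'] is [|i - 1|]: for [i = 0] the frequency -1 is replaced by 1, as [sin ^ 2] is even. *)
pose i' := if i is i.+1 then i else 1%N.
exists [:: (b / 2, i), (b / 2, 1%N), (- b / 4, i.+1), (- b / 4, i') & s'].
split => [x|]; rewrite !big_cons /=; last first.
  by rewrite IH2 /i'; case: i {i'} => [|i]; rewrite -?natr1; field.
rewrite mulrDl IH1 -mulrA sin2_mul.
have -> : sin (i'%:R * x) ^+ 2 = sin (i%:R * x - x) ^+ 2.
  rewrite /i'; case: i {i'} => [|i]; last by rewrite -natr1 mulrDl mul1r addrK.
  by rewrite mul1r mul0r sub0r sinN sqrrN.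
by rewrite -[i.+1%:R]natr1 mulrDl !mul1r; field.
Qed.

(** The second conjunct is the first one divided by [x ^ 2] at [x = 0]; [sinc2_comb] needs it there,
    where it cannot divide. *)
Lemma poly_sin2_comb {R : realType} (P : {poly R}) :
  exists s : seq (R * nat),
    (forall x, sin x ^+ 2 * P.[sin x ^+ 2] = sin2_comb s x) /\
    \sum_(p <- s) p.1 * p.2%:R ^+ 2 = P.[0].
Proof.
elim/poly_ind: P => [|P c [s [IH1 IH2]]].
  by exists [::]; rewrite /sin2_comb; split => [x|]; rewrite !big_nil horner0 ?mulr0.
have [s' [h1 h2]] := sin2_comb_mul s.
exists ((c, 1%N) :: s'); split => [x|].
  rewrite hornerMXaddC /sin2_comb big_cons /= mul1r -/(sin2_comb s' x) -h1 -IH1.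
  by ring.
by rewrite hornerMXaddC big_cons h2 /=; ring.
Qed.

Lemma sinc2_comb {R : realType} (P : {poly R}) :
  exists s : seq (R * nat), forall x,
    sinc2 x * P.[sin x ^+ 2]
      = \sum_(p <- s) p.1 * p.2%:R ^+ 2 * sinc2 (p.2%:R * x).
Proof.
have [s [h1 h2]] := poly_sin2_comb P; exists s => x.
have [->|x0] := eqVneq x 0.
  rewrite sin0 expr0n/= -h2 {1}/sinc2 eqxx mul1r; apply: eq_bigr => p _.
  by rewrite mulr0 /sinc2 eqxx mulr1.
apply: (@mulfI _ (x ^+ 2)); first by rewrite expf_neq0.
rewrite mulrA sinc2_sqr h1 mulr_sumr /sin2_comb; apply: eq_bigr => p _.
by rewrite -sinc2_sqr; ring.
Qed.

Lemma norm_sin_le {R : realType} (x : R) : `|sin x| <= `|x|.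
Proof.
wlog x0 : x / 0 <= x.
  move=> H; have [/H//|x0] := leP 0 x.
  by rewrite -normrN -sinN -[`|x|]normrN; apply: H; rewrite oppr_ge0 ltW.
have [|c _] := @MVT_segment R sin cos 0 x x0 (fun z _ => is_derive_sin z).
  by apply: continuous_subspaceT; exact: continuous_sin.
rewrite sin0 !subr0 => ->; rewrite normrM ler_piMl//; exact: cos_max.
Qed.

Lemma cos_ge_quad {R : realType} (x : R) : 1 - x ^+ 2 / 2 <= cos x.
Proof.
have -> : cos x = 1 - 2 * sin (x / 2) ^+ 2.
  rewrite {1}(splitr x) cosD -!expr2 cos2sin2; ring.
have h := norm_sin_le (x / 2).
have : sin (x / 2) ^+ 2 <= (x / 2) ^+ 2.
  by rewrite -(real_normK (num_real (sin _))) -(real_normK (num_real (x / 2))) lerXn2r.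
by rewrite exprMn; lra.
Qed.

Lemma sin_ge_cubic {R : realType} (x : R) :
  0 <= x -> x * (1 - x ^+ 2 / 2) <= sin x.
Proof.
move=> x0.
have [|c] := @MVT_segment R sin cos 0 x x0 (fun z _ => is_derive_sin z).
  by apply: continuous_subspaceT; exact: continuous_sin.
rewrite sin0 !subr0 in_itv /= => /andP[c0 cx] ->.
rewrite mulrC ler_wpM2r//; apply: le_trans (cos_ge_quad c).
by rewrite lerB// ler_pM2r// lerXn2r// nnegrE.
Qed.

Lemma sinc2_le1 {R : realType} (x : R) : sinc2 x <= 1.
Proof.
rewrite /sinc2; case: eqP => // /eqP x0.
rewrite -(real_normK (num_real (sin x / x))) expr_le1// normrM normfV.
by rewrite ler_pdivrMr ?normr_gt0// mul1r norm_sin_le.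
Qed.

Lemma sinc2_ge {R : realType} (x : R) : 0 <= x <= 1 ->
  (1 - x ^+ 2 / 2) ^+ 2 <= sinc2 x.
Proof.
move=> /andP[x0 x1]; rewrite /sinc2; case: eqP => [->|/eqP x0'].
  by rewrite expr0n/= mul0r subr0 expr1n.
have x2 : x ^+ 2 <= 1 by rewrite expr_le1.
rewrite lerXn2r ?nnegrE//; first by lra.
  rewrite divr_ge0//; apply: le_trans (sin_ge_cubic x x0).
  by rewrite mulr_ge0//; lra.
by rewrite ler_pdivlMr ?lt_def ?x0'// mulrC sin_ge_cubic.
Qed.

(** All that the Tauberian part knows of the graph: [a j] stands for [d psi_j(q) ^ 2], and the limit
    is the same for every point. *)
Definition sampled {R : realType} (T : R) (k a : nat -> R) : Prop :=
  (forall j, 0 <= a j) /\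
  (forall t, 0 < t <= T ->
    (fun N => \sum_(j < N) a j * sinc2 (t * k j)) @ \oo --> t^-1).

Lemma lim_le_eventually {R : realType} (u : nat -> R) (l B : R) :
  u @ \oo --> l -> (exists N0, forall N, (N0 <= N)%N -> u N <= B) -> l <= B.
Proof.
move=> ul [N0 uB]; apply: (cvgr_to_le ul).
by exists N0 => // N /= /uB.
Qed.

Lemma lim_ge_eventually {R : realType} (u : nat -> R) (l B : R) :
  u @ \oo --> l -> (exists N0, forall N, (N0 <= N)%N -> B <= u N) -> B <= l.
Proof.
move=> ul [N0 uB]; apply: (cvgr_to_ge ul).
by exists N0 => // N /= /uB.
Qed.

Lemma ler_sum_initial {R : realType} (u : nat -> R) (M N : nat) :
  (M <= N)%N -> (forall j, 0 <= u j) ->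
  \sum_(j < M) u j <= \sum_(j < N) u j.
Proof.
move=> /subnKC <- u0; rewrite big_split_ord/= lerDl sumr_ge0//.
Qed.

(** A term [b i ^ 2 sinc2 (i x)] of the kernel is sampled at time [i t], where it contributes
    [b i ^ 2 / (i t) = (b i) / t]. Hence [J] is the sum of the [b i], and [m] exceeds every [i].
    Both depend on [P] only, which is what allows two weights to be compared. *)
Lemma sampled_poly {R : realType} (P : {poly R}) :
  exists m J : R, 0 < m /\ forall T k a, sampled T k a ->
    forall t, 0 < t -> m * t <= T ->
    (fun N => \sum_(j < N) a j * (sinc2 (t * k j) * P.[sin (t * k j) ^+ 2]))
      @ \oo --> J / t.
Proof.
have [s hs] := sinc2_comb P.
exists (1 + \sum_(p <- s) p.2%:R), (\sum_(p <- s) p.1 * p.2%:R).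
split; first by rewrite ltr_pwDl// sumr_ge0.
move=> T k a [a0 ha] t t0 tT.
have -> : (fun N => \sum_(j < N) a j * (sinc2 (t * k j) * P.[sin (t * k j) ^+ 2]))
  = (fun N => \sum_(p <- s) p.1 * p.2%:R ^+ 2
       * \sum_(j < N) a j * sinc2 (p.2%:R * t * k j)).
  apply/funext => N; under eq_bigr => j _ do rewrite hs mulr_sumr.
  rewrite exchange_big/=; apply: eq_bigr => p _; rewrite mulr_sumr.
  by apply: eq_bigr => j _; rewrite -[p.2%:R * t * k j]mulrA; ring.
rewrite mulr_suml; elim: s tT {hs} => [|[b i] s IH] tT.
  rewrite big_nil; under eq_fun do rewrite big_nil; exact: cvg_cst.
move: tT; rewrite !big_cons /= => tT; under eq_fun do rewrite big_cons /=.
have s0 : 0 <= \sum_(p <- s) (p.2%:R : R) by rewrite sumr_ge0.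
have i0 : 0 <= i%:R :> R by [].
apply: cvgD; last first.
  apply: IH; apply: le_trans tT; rewrite ler_pM2r//; lra.
have [->|iN0] := eqVneq i 0%N.
  rewrite mulr0 mul0r expr0n/= mulr0; under eq_fun do rewrite mul0r; exact: cvg_cst.
have ip : 0 < i%:R :> R by rewrite ltr0n lt0n.
have -> : b * i%:R / t = b * i%:R ^+ 2 * (i%:R * t)^-1 by field; rewrite !gt_eqF.
apply: cvgMr; apply: ha; rewrite mulr_gt0//=.
by apply: le_trans tT; rewrite ler_pM2r//; lra.
Qed.

(** * Linear growth of the partial sums of the weights *)

Lemma sampled_partial_le {R : realType} (T : R) (k a : nat -> R) (t : R) N :
  sampled T k a -> 0 < t <= T -> \sum_(j < N) a j * sinc2 (t * k j) <= t^-1.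
Proof.
move=> [a0 ha] tT; apply: (lim_ge_eventually _ _ _ (ha t tT)); exists N => M NM.
by apply: (ler_sum_initial (fun j => a j * sinc2 (t * k j)) _ _ NM) => j;
  rewrite mulr_ge0// sinc2_ge0.
Qed.

(** At time [1 / K] all arguments lie in [0, 1], where [sinc2] is at least [(1 / 2) ^ 2]; hence the
    factor 4. *)
Lemma sampled_sum_le {R : realType} (T K : R) (k a : nat -> R) (N : nat) :
  0 < T -> T^-1 <= K -> sampled T k a ->
  (forall j, (j < N)%N -> 0 <= k j <= K) -> \sum_(j < N) a j <= 4 * K.
Proof.
move=> T0 TK ha hk.
have K0 : 0 < K by apply: lt_le_trans TK; rewrite invr_gt0.
have : \sum_(j < N) a j * sinc2 (K^-1 * k j) <= K^-1^-1.
  by apply: (sampled_partial_le _ _ _ _ _ ha); rewrite invr_gt0 K0/= invf_ple.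
rewrite invrK -(ler_pM2l (_ : 0 < 4))// => /(le_trans _); apply.
rewrite mulr_sumr; apply: ler_sum => j _.
have /andP[k0 kK] := hk j (ltn_ord j).
have x01 : 0 <= K^-1 * k j <= 1.
  apply/andP; split; first by rewrite mulr_ge0// invr_ge0 ltW.
  by rewrite mulrC ler_pdivrMr// mul1r.
have h := sinc2_ge _ x01; move: x01 h.
set x := K^-1 * k j => /andP[x0 x1] h.
have x2 : x ^+ 2 <= 1 by rewrite expr_le1.
have h4 : (1 / 2) ^+ 2 <= (1 - x ^+ 2 / 2) ^+ 2 :> R by rewrite lerXn2r ?nnegrE; lra.
rewrite mulrCA ler_peMr//; first exact: ha.1.
by have := le_trans h4 h; lra.
Qed.

(* Abel summation against the linear growth of the partial sums. *)
Lemma sampled_tail_le {R : realType} (T K : R) (k a : nat -> R) (N : nat) :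
  0 < T -> T^-1 <= K -> sampled T k a ->
  (forall j, 0 <= k j) -> {homo k : i j / (i <= j)%N >-> i <= j} ->
  \sum_(j < N) (if K < k j then a j / k j ^+ 2 else 0) <= 8 / K.
Proof.
move=> T0 TK ha hk hmono; have a0 := ha.1.
have K0 : 0 < K by apply: lt_le_trans TK; rewrite invr_gt0.
pose u j := if K < k j then a j / k j ^+ 2 else 0.
have zero n : k n <= K -> \sum_(j < n.+1) u j = 0.
  move=> kn; apply: big1 => j _; rewrite /u ifF//; apply/negbTE; rewrite -leNgt.
  by apply: le_trans kn; apply: hmono; rewrite -ltnS.
have S_le n : K < k n -> \sum_(j < n.+1) a j <= 4 * k n.
  move=> Kn; apply: (sampled_sum_le _ _ _ _ _ T0 _ ha) => [|j jn].
    exact: le_trans TK (ltW Kn).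
  by rewrite hk hmono.
(* A boundary term plus the integral of [8 / s ^ 2] from [K] to [k n]: the latter is the integral of
   [2 A / s ^ 3] with the partial sum [A] bounded by [4 s]. *)
have key n : K < k n -> \sum_(j < n.+1) u j
    <= (\sum_(j < n.+1) a j) / k n ^+ 2 + 8 * (K^-1 - (k n)^-1).
  elim: n => [|n IH] Kn; rewrite big_ord_recr/= {2}/u Kn.
    rewrite big_ord0 add0r big_ord_recr/= big_ord0 add0r lerDl mulr_ge0//.
    by rewrite subr_ge0 lef_pV2 ?posrE// ?ltW// (lt_trans K0).
  have kn1 : 0 < k n.+1 by exact: lt_trans Kn.
  rewrite [X in _ <= X / _ + _]big_ord_recr/= mulrDl.
  have [knK|Kn'] := leP (k n) K.
    rewrite zero// add0r -addrA [X in _ <= X]addrCA lerDl addr_ge0//.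
      by rewrite divr_ge0 ?sqr_ge0// sumr_ge0.
    by rewrite mulr_ge0// subr_ge0 lef_pV2 ?posrE// ltW.
  have {IH} := IH Kn'; have := S_le n Kn'.
  set S := \sum_(j < n.+1) a j => SK IH.
  have kn0 : 0 < k n by exact: lt_trans Kn'.
  have kk : k n <= k n.+1 by exact: hmono.
  rewrite [X in _ <= X]addrAC lerD2r; apply: le_trans IH _.
  rewrite -subr_ge0.
  have -> : S / k n.+1 ^+ 2 + 8 * (K^-1 - (k n.+1)^-1) -
    (S / k n ^+ 2 + 8 * (K^-1 - (k n)^-1)) =
    ((k n.+1 - k n) / (k n ^+ 2 * k n.+1 ^+ 2)) *
    (8 * (k n * k n.+1) - S * (k n.+1 + k n)) by field; rewrite !gt_eqF.
  rewrite mulr_ge0// ?divr_ge0 ?subr_ge0// ?mulr_ge0 ?sqr_ge0//.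
  have h : S * (k n.+1 + k n) <= 4 * k n * (k n.+1 + k n).
    by rewrite ler_wpM2r// addr_ge0// ltW.
  apply: le_trans h _.
  have : k n * k n <= k n * k n.+1 by rewrite ler_pM2l.
  by lra.
case: N => [|n]; first by rewrite big_ord0 divr_ge0// ltW.
have [knK|Kn] := leP (k n) K; first by rewrite zero// divr_ge0// ltW.
have kn0 : 0 < k n by exact: lt_trans Kn.
apply: le_trans (key n Kn) _.
have h : (\sum_(j < n.+1) a j) / k n ^+ 2 <= 4 / k n.
  rewrite ler_pdivrMr ?exprn_gt0//; apply: le_trans (S_le n Kn) _.
  by rewrite le_eqVlt; apply/orP; left; apply/eqP; field; rewrite gt_eqF.
have : 0 <= (k n)^-1 by rewrite invr_ge0 ltW.
by lra.
Qed.

(** At time [t = 32 / k N] the full sum is [k N / 32], while the indices from [N] on contribute at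
    most [t ^- 2 * (16 / k N) = k N / 64]; half of the sum is left for the indices below [N]. *)
Lemma sampled_sum_ge {R : realType} (T : R) (k a : nat -> R) (N : nat) :
  0 < T -> 32 / T <= k N -> sampled T k a ->
  (forall j, 0 <= k j) -> {homo k : i j / (i <= j)%N >-> i <= j} ->
  k N / 64 <= \sum_(j < N) a j.
Proof.
move=> T0 TK ha hk hmono; have a0 := ha.1.
have kN : 0 < k N by apply: lt_le_trans TK; rewrite divr_gt0.
pose t := 32 / k N; have t0 : 0 < t by rewrite divr_gt0.
have tT : 0 < t <= T.
  by rewrite t0 /t ler_pdivrMr// mulrC -ler_pdivrMr.
(* The tail bound is used from [k N / 2] and not from [k N]: its condition [K < k j] is strict, and
   [k N] itself belongs to the tail. *)
have K1 : T^-1 <= k N / 2.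
  have : 0 <= T^-1 by rewrite invr_ge0 ltW.
  by lra.
have : t^-1 <= \sum_(j < N) a j + t ^- 2 * (8 / (k N / 2)).
  apply: (lim_le_eventually _ _ _ (ha.2 t tT)); exists N => M /subnKC <-.
  move: (M - N)%N => {M} d; have h := sampled_tail_le _ _ _ _ (N + d) T0 K1 ha hk hmono.
  apply: le_trans (lerD (lexx _) (ler_wpM2l _ h)); last by rewrite invr_ge0 sqr_ge0.
  rewrite !big_split_ord/= mulrDr addrA lerD//.
    rewrite ler_wpDr//.
      rewrite mulr_ge0 ?invr_ge0 ?sqr_ge0// sumr_ge0// => j _.
      by case: ifP => // _; rewrite divr_ge0 ?sqr_ge0.
    by apply: ler_sum => j _; rewrite ler_piMr// sinc2_le1.
  rewrite mulr_sumr; apply: ler_sum => j _.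
  have kNj : k N <= k (N + j)%N by apply: hmono; rewrite leq_addr.
  have kj : 0 < k (N + j)%N by exact: lt_le_trans kNj.
  rewrite ifT; last by lra.
  rewrite [X in _ <= X](_ : _ = a (N + j)%N * (t * k (N + j)%N) ^- 2); last first.
    by field; rewrite !gt_eqF.
  rewrite ler_wpM2l// -[X in _ <= X]mul1r ler_pdivlMr ?exprn_gt0//; last exact: mulr_gt0 t0 kj.
  rewrite mulrC sinc2_sqr -(real_normK (num_real (sin _))) expr_le1//.
  exact: sin_max.
have -> : t ^- 2 * (8 / (k N / 2)) = k N / 64.
  by rewrite /t; field; rewrite gt_eqF.
by rewrite /t invf_div; lra.
Qed.

(** * Cutoffs and the comparison of two weights *)

Lemma linear_cutoff {R : realType} (z0 z1 : R) : z0 < z1 ->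
  exists f : R -> R,
    [/\ forall x y, `|f x - f y| <= (z1 - z0)^-1 * `|x - y|,
        forall z, 0 <= f z <= 1,
        forall z, z <= z0 -> f z = 1 &
        forall z, z1 <= z -> f z = 0].
Proof.
move=> z01; have w0 : 0 < z1 - z0 by rewrite subr_gt0.
have wV : 0 < (z1 - z0)^-1 by rewrite invr_gt0.
pose g z := (z1 - z) / (z1 - z0).
pose f z := if z <= z0 then 1 else if z1 <= z then 0 else g z.
have f01 z : 0 <= f z <= 1.
  rewrite /f; case: ifPn => [_|]; first by rewrite lexx ler01.
  rewrite -ltNge => z0z; case: ifPn => [_|]; first by rewrite lexx ler01.
  rewrite -ltNge => zz1; rewrite /g; apply/andP; split.
    by rewrite divr_ge0// ltW// subr_gt0.
  by rewrite ler_pdivrMr// mul1r; lra.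
exists f; split=> //.
- move=> x y; wlog xy : x y / x <= y.
    move=> H; have [/H//|/ltW/H] := leP x y.
    by rewrite distrC [`|y - x|]distrC.
  have fyx : f y <= f x.
    rewrite /f /g; case: ifPn => [yz0|]; first by rewrite (le_trans xy yz0).
    case: ifPn => [z1y _|]; first by have /andP[] := f01 x.
    rewrite -!ltNge => yz1 z0y; case: ifPn => [xz0|].
      by rewrite ler_pdivrMr// mul1r; lra.
    by rewrite -ltNge => z0x; rewrite [z1 <= x]leNgt (le_lt_trans xy yz1)/= ler_pM2r//; lra.
  rewrite (ger0_norm (_ : 0 <= f x - f y)) ?subr_ge0// [`|x - y|]distrC.
  rewrite ger0_norm ?subr_ge0// mulrC ler_pdivlMr//.
  rewrite /f /g; case: ifPn => [xz0|].
    case: ifPn => [yz0|]; first by rewrite subrr mul0r subr_ge0.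
    rewrite -ltNge => z0y; case: ifPn => [z1y|].
      by rewrite subr0 mul1r; lra.
    by rewrite -ltNge => yz1; rewrite mulrBl mul1r divfK ?gt_eqF//; lra.
  rewrite -ltNge => z0x; rewrite [y <= z0]leNgt (lt_le_trans z0x xy)/=.
  case: ifPn => [z1x|]; first by rewrite (le_trans z1x xy) subrr mul0r subr_ge0.
  rewrite -ltNge => xz1; case: ifPn => [z1y|].
    by rewrite subr0 divfK ?gt_eqF//; lra.
  by rewrite -ltNge => yz1; rewrite mulrBl !divfK ?gt_eqF//; lra.
- by move=> z; rewrite /f => ->.
- by move=> z z1z; rewrite /f z1z [z <= z0]leNgt (lt_le_trans z01 z1z).
Qed.

Lemma sin2_le_sqr {R : realType} (x : R) : sin x ^+ 2 <= x ^+ 2.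
Proof.
rewrite -(real_normK (num_real (sin x))) -(real_normK (num_real x)).
by rewrite lerXn2r// norm_sin_le.
Qed.

(** The surplus of [3 d] over [d] pays for the cubic loss of [sin]: below [4 d] that loss is a
    factor of at least [1 - d], and above [4 d] the crude bound [x / 2] is enough. *)
Lemma sin_ge_past {R : realType} (d x : R) : 0 < d <= 1 / 8 ->
  d * (1 + 3 * d) <= x <= 1 -> d * (1 + d) <= sin x.
Proof.
move=> /andP[d0 d8] /andP[dx x1]; have x0 : 0 <= x.
  by apply: le_trans dx; nra.
apply: le_trans (sin_ge_cubic x x0).
have [x4|x4] := leP (4 * d) x.
  have x2 : x ^+ 2 <= 1 by rewrite expr_le1.
  have : x / 2 <= x * (1 - x ^+ 2 / 2) by rewrite ler_wpM2l//; lra.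
  by apply: le_trans; nra.
have x2 : x ^+ 2 <= (4 * d) ^+ 2 by rewrite lerXn2r ?nnegrE// ltW// mulr_gt0.
have h : 1 - d <= 1 - x ^+ 2 / 2 by nra.
apply: le_trans (_ : d * (1 + 3 * d) * (1 - d) <= _).
  by rewrite -mulrA ler_pM2l//; nra.
by apply: ler_pM => //; nra.
Qed.

(* With [f] a cutoff from 1 to 0 on [d^2, (d (1 + d))^2] and [P] close to [f],
   the function [sinc2 x * P.[sin x ^+ 2]] approximates the indicator of
   [x <= d], up to the periods away from 0, where [sinc2] is small.  Evaluated
   at [t = d / k N] and [t = d (1 + 3 d) / k N] it bounds the partial sum from
   above and below by the same constant [J]. *)
Lemma sampled_sandwich {R : realType} (d : R) : 0 < d <= 1 / 8 ->
  exists m J : R, 0 < m /\ forall T k a,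
    0 < T -> sampled T k a ->
    (forall j, 0 <= k j) -> {homo k : i j / (i <= j)%N >-> i <= j} ->
    forall N, m / T <= k N ->
      (1 - d ^+ 2) * \sum_(j < N) a j <= (J + d) * k N /\
      (J - 19 * d) * k N <= (1 + 3 * d) * \sum_(j < N) a j.
Proof.
move=> d018; have /andP[d0 d8] := d018.
have dd : d ^+ 2 < (d * (1 + d)) ^+ 2.
  by rewrite ltrXn2r ?nnegrE ?ltW ?mulr_gt0//; nra.
have [f [flip f01 f1 f0]] := linear_cutoff _ _ dd.
have L0 : 0 < ((d * (1 + d)) ^+ 2 - d ^+ 2)^-1 by rewrite invr_gt0 subr_gt0.
(* With tolerance [d ^ 2] the approximation error is at most [d ^ 2 / t], that is [d * k N] at
   [t = d / k N]. *)
have eta0 : 0 < d * d by rewrite mulr_gt0.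
have [P hP] := lipschitz_poly_approx f _ _ L0 eta0 flip.
have {}hP (x : R) : `|P.[sin x ^+ 2] - f (sin x ^+ 2)| <= d * d.
  apply: hP; rewrite sqr_ge0/= -(real_normK (num_real (sin x))) expr_le1//.
  exact: sin_max.
have [m [J [m0 hJ]]] := sampled_poly P.
(* At [t = d / k N] the limit [J / t] of [sampled_poly] is [(J / d) * k N]. The extra 1 makes
   [t <= T] hold along with [m * t <= T]. *)
exists (m + 1), (J / d); split; first by rewrite addr_gt0.
move=> T k a T0 ha hk hmono N mk; have a0 := ha.1.
have kN : 0 < k N by apply: lt_le_trans mk; rewrite divr_gt0// addr_gt0.
have small t : 0 < t -> t * k N <= 1 -> m * t <= T /\ 0 < t <= T.
  move=> t0 tk; have mt : m * t + t <= T.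
    move: mk; rewrite ler_pdivrMr// => mk.
    rewrite -(ler_pM2r kN) mulrDl -mulrA [T * _]mulrC; apply: le_trans mk.
    by rewrite lerD// ler_piMr// ltW.
  have : 0 < m * t by rewrite mulr_gt0.
  by rewrite t0 /=; split; lra.
split.
- pose t := d / k N; have t0 : 0 < t by rewrite divr_gt0.
  have [mt tT] : m * t <= T /\ 0 < t <= T.
    by apply: small => //; rewrite /t divfK ?gt_eqF//; lra.
  have : (1 - d ^+ 2) * (\sum_(j < N) a j) - d * d * t^-1 <= J / t.
    apply: (lim_ge_eventually _ _ _ (hJ T k a ha t t0 mt)); exists N => M NM.
    have h1 : (1 - d ^+ 2) * (\sum_(j < N) a j)
        <= \sum_(j < M) a j * (sinc2 (t * k j) * f (sin (t * k j) ^+ 2)).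
      have := ler_sum_initial
        (fun j => a j * (sinc2 (t * k j) * f (sin (t * k j) ^+ 2))) _ _ NM.
      have h j : 0 <= a j * (sinc2 (t * k j) * f (sin (t * k j) ^+ 2)).
        rewrite mulr_ge0// mulr_ge0 ?sinc2_ge0//.
        by have /andP[] := f01 (sin (t * k j) ^+ 2).
      move=> /(_ h); apply: le_trans; rewrite mulr_sumr; apply: ler_sum => j _.
      rewrite mulrC ler_wpM2l//.
      have x0 : 0 <= t * k j by rewrite mulr_ge0// ltW.
      have xd : t * k j <= d.
        by rewrite /t mulrAC ler_pdivrMr// ler_pM2l// hmono// ltnW.
      set x := t * k j in x0 xd *.
      have x2 : x ^+ 2 <= d ^+ 2 by rewrite lerXn2r// nnegrE// ltW.
      rewrite f1 ?(le_trans (sin2_le_sqr x))// mulr1.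
      have : 0 <= x <= 1 by rewrite x0/=; lra.
      move=> /sinc2_ge; apply: le_trans.
      have := sqr_ge0 x; nra.
    have h2 : \sum_(j < M) a j * (sinc2 (t * k j) * f (sin (t * k j) ^+ 2))
       <= \sum_(j < M) a j * (sinc2 (t * k j) * P.[sin (t * k j) ^+ 2])
         + d * d * \sum_(j < M) a j * sinc2 (t * k j).
      rewrite mulr_sumr -big_split/=; apply: ler_sum => j _.
      rewrite [d * d * _]mulrCA -mulrDr ler_wpM2l// [d * d * _]mulrC -mulrDr.
      rewrite ler_wpM2l ?sinc2_ge0//.
      by have := hP (t * k j); rewrite ler_norml => /andP[? ?]; lra.
    have h3 := ler_wpM2l (ltW eta0) (sampled_partial_le _ _ _ _ M ha tT).
    by rewrite lerBlDr; apply: le_trans h1 (le_trans h2 _); rewrite lerD2l.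
  rewrite lerBlDr => /le_trans; apply.
  by rewrite /t le_eqVlt; apply/orP; left; apply/eqP; field; rewrite !gt_eqF.
- have r0 : 0 < 1 + 3 * d by rewrite addr_gt0// mulr_gt0.
  pose t := d * (1 + 3 * d) / k N.
  have t0 : 0 < t by rewrite divr_gt0// mulr_gt0.
  have [mt tT] : m * t <= T /\ 0 < t <= T.
    by apply: small => //; rewrite /t divfK ?gt_eqF//; nra.
  have TV : T^-1 <= t^-1 by rewrite lef_pV2 ?posrE//; case/andP: tT.
  pose c := (d * (1 + d)) ^+ 2.
  (* For [j >= N] the argument is past [d (1 + 3 d)]. Up to 1, [f] vanishes by [sin_ge_past]. Beyond
     1, [f] vanishes unless [sin ^ 2 < c], so [sinc2 * f] is at most [c / (t * k j) ^ 2], and the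
     tail bound from [1 / t] on gives [8 c / t]. *)
  have : J / t <= \sum_(j < N) a j + c / t ^+ 2 * (8 / t^-1) + d * d * t^-1.
    apply: (lim_le_eventually _ _ _ (hJ T k a ha t t0 mt)); exists N => M NM.
    have h1 : \sum_(j < M) a j * (sinc2 (t * k j) * P.[sin (t * k j) ^+ 2])
       <= \sum_(j < M) a j * (sinc2 (t * k j) * f (sin (t * k j) ^+ 2))
         + d * d * \sum_(j < M) a j * sinc2 (t * k j).
      rewrite mulr_sumr -big_split/=; apply: ler_sum => j _.
      rewrite [d * d * _]mulrCA -mulrDr ler_wpM2l// [d * d * _]mulrC -mulrDr.
      rewrite ler_wpM2l ?sinc2_ge0//.
      by have := hP (t * k j); rewrite ler_norml => /andP[? ?]; lra.
    have h3 := ler_wpM2l (ltW eta0) (sampled_partial_le _ _ _ _ M ha tT).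
    apply: le_trans h1 _; apply: lerD => //.
    have h4 := sampled_tail_le _ _ _ _ M T0 TV ha hk hmono.
    have c0 : 0 <= c / t ^+ 2 by rewrite divr_ge0 ?sqr_ge0.
    have h5 : \sum_(j < N) a j = \sum_(j < M) if (j < N)%N then a j else 0.
      by rewrite -big_mkcond/= (big_ord_widen M a NM).
    rewrite h5; apply: le_trans (lerD (lexx _) (ler_wpM2l c0 h4)).
    rewrite mulr_sumr -big_split/=; apply: ler_sum => j _.
    have x0 : 0 <= t * k j by rewrite mulr_ge0// ltW.
    have /andP[fge0 fle1] := f01 (sin (t * k j) ^+ 2).
    have s0 := sinc2_ge0 (t * k j); have s1 := sinc2_le1 (t * k j).
    have tail0 : 0 <= c / t ^+ 2 * (if t^-1 < k j then a j / k j ^+ 2 else 0).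
      by rewrite mulr_ge0//; case: ifP => // _; rewrite divr_ge0 ?sqr_ge0.
    have [jN|Nj] := ltnP j N.
      rewrite ler_wpDr// ler_piMr// mulr_ile1//.
    rewrite add0r.
    have dx : d * (1 + 3 * d) <= t * k j.
      by rewrite /t mulrAC ler_pdivlMr// ler_pM2l ?mulr_gt0// hmono.
    have [x1|x1] := leP (t * k j) 1.
      have hs : d * (1 + d) <= sin (t * k j) by apply: sin_ge_past; rewrite // dx.
      rewrite f0 ?mulr0 ?mulr0// lerXn2r ?nnegrE//.
        by nra.
      by apply: le_trans hs; nra.
    rewrite ifT; last by rewrite -[_^-1]mul1r ltr_pdivrMr// mulrC.
    have kj : 0 < k j by rewrite -(pmulr_rgt0 _ t0) (lt_trans _ x1).
    have xp : 0 < (t * k j) ^+ 2 by rewrite exprn_gt0// (lt_trans _ x1).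
    rewrite [X in _ <= X](_ : _ = a j * (c / (t * k j) ^+ 2)); last first.
      by field; rewrite !gt_eqF.
    rewrite ler_wpM2l// ler_pdivlMr// mulrC mulrA sinc2_sqr.
    have [z|z] := leP c (sin (t * k j) ^+ 2); first by rewrite f0// mulr0 sqr_ge0.
    by apply: le_trans (ltW z); rewrite ler_piMr// sqr_ge0.
  set S := \sum_(j < N) a j => h.
  have -> : (J / d - 19 * d) * k N = (1 + 3 * d) * (J / t - 19 * (d * d) / t).
    by rewrite /t; field; rewrite !gt_eqF.
  rewrite ler_pM2l// lerBlDr; apply: le_trans h _.
  rewrite -addrA lerD2l.
  have -> : c / t ^+ 2 * (8 / t^-1) + d * d / t = (8 * c + d * d) / t.
    by field; rewrite gt_eqF.
  rewrite ler_pM2r ?invr_gt0// /c; nra.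
Qed.

(* The constant [C] does not depend on [a] and [b]: this makes the local law
   uniform in the point of the graph. *)
Lemma sampled_sum_close {R : realType} (eps : R) : 0 < eps ->
  exists C : R, 0 < C /\ forall T k a b,
    0 < T -> sampled T k a -> sampled T k b ->
    (forall j, 0 <= k j) -> {homo k : i j / (i <= j)%N >-> i <= j} ->
    forall N, C / T <= k N ->
      \sum_(j < N) a j - \sum_(j < N) b j <= eps * k N.
Proof.
(* [J] cancels between the two bounds, which leaves [20 d k N]. As both sums are at most [4 k N],
   the term [3 d B] costs [12 d k N] and [d ^ 2 A] costs at most [d k N / 2]. *)
move=> e0; pose d := Num.min (1 / 8) (eps / 33).
have d0 : 0 < d by rewrite /d lt_min !divr_gt0.
have d8 : d <= 1 / 8 by rewrite /d ge_min lexx.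
have d33 : 33 * d <= eps.
  by rewrite -ler_pdivlMl// mulrC /d ge_min lexx orbT.
have d08 : 0 < d <= 1 / 8 by rewrite d0.
have [m [J [m0 H]]] := sampled_sandwich d d08.
exists (m + 1); split; first by rewrite addr_gt0.
move=> T k a b T0 ha hb hk hmono N CN.
have TN : T^-1 <= k N.
  by apply: le_trans CN; rewrite mulrDl mul1r lerDr divr_ge0// ltW.
have mN : m / T <= k N.
  by apply: le_trans CN; rewrite ler_pM2r ?invr_gt0// lerDl.
have kN : 0 < k N by apply: lt_le_trans TN; rewrite invr_gt0.
have bd c : sampled T k c -> \sum_(j < N) c j <= 4 * k N.
  move=> hc; apply: (sampled_sum_le _ _ _ _ _ T0 TN hc) => j jN.
  by rewrite hk hmono// ltnW.
have [h1 _] := H T k a T0 ha hk hmono N mN.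
have [_ h2] := H T k b T0 hb hk hmono N mN.
have := bd _ ha; have := bd _ hb; move: h1 h2.
set A := \sum_(j < N) a j; set B := \sum_(j < N) b j => h1 h2 hB hA.
have h3 : d ^+ 2 * A <= d ^+ 2 * (4 * k N) by rewrite ler_wpM2l// sqr_ge0.
have h4 : d * B <= d * (4 * k N) by rewrite ler_wpM2l// ltW.
have h5 : d ^+ 2 * k N <= (d / 8) * k N by rewrite ler_pM2r//; nra.
have h6 : 33 * d * k N <= eps * k N by rewrite ler_wpM2r// ltW.
clearbody d; nra.
Qed.

(** * Step and ramp integrals on an interval *)

Definition step {R : realType} (a x : R) : R := (x <= a)%R%:R.

Definition ramp {R : realType} (a x : R) : R := Num.max 0 (a - x).

Lemma ramp_step {R : realType} (a x : R) : ramp a x = step a x * (a - x).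
Proof.
rewrite /ramp /step; case: (leP x a) => xa.
  by rewrite mul1r max_r// subr_ge0.
by rewrite mul0r max_l// subr_le0 ltW.
Qed.

(** The primitive of [g] from 0, extended by constants outside [0, l]: a ball that sticks out of an
    edge then needs no separate formula. *)
Definition stepint {R : realType} (l : R) (g : R -> R) (a : R) : R :=
  (\int[@lebesgue_measure R]_(x in `[0%R, l]) (step a x * g x))%R.

Definition intg {R : realType} (l : R) (g : R -> R) : Prop :=
  (@lebesgue_measure R).-integrable `[0%R, l] (EFin \o g).

Lemma measurable_step {R : realType} (D : set R) (a : R) :
  measurable_fun D (step a).
Proof.
apply: measurable_funTS.
rewrite (_ : step a = \1_(`]-oo, a]%classic)); last first.
  apply/funext => x; rewrite /step indicE; congr (nat_of_bool _)%:R.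
  by apply/idP/idP; rewrite inE /= in_itv.
exact: measurable_indic.
Qed.

Lemma intg_step {R : realType} (l a : R) (g : R -> R) :
  intg l g -> intg l (fun x => step a x * g x).
Proof.
move=> ig; have mg := measurable_int _ ig.
apply: (le_integrable _ _ _ ig) => //.
  apply/measurable_EFinP; apply: measurable_funM; first exact: measurable_step.
  exact/measurable_EFinP.
move=> x _ /=; rewrite lee_fin normrM /step.
by case: (x <= a); rewrite ?normr1 ?mul1r// normr0 mul0r.
Qed.

Lemma stepint_in {R : realType} (l a : R) (g : R -> R) : 0 <= a <= l ->
  stepint l g a = (\int[@lebesgue_measure R]_(x in `[0%R, a]) g x)%R.
Proof.
move=> /andP[a0 al]; rewrite /stepint.
rewrite (_ : (fun x => step a x * g x) = g \_ `]-oo, a]); last first.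
  apply/funext => x; rewrite patchE /step mem_setE in_itv/=.
  by case: (x <= a); rewrite ?mul1r ?mul0r.
rewrite -Rintegral_mkcondr; congr (Rintegral _ _ _).
apply/seteqP; split => x /=; rewrite !in_itv/=; last first.
  by move=> /andP[-> xa]; rewrite (le_trans xa al).
by move=> [/andP[-> _] ->].
Qed.

Lemma stepint_lt0 {R : realType} (l a : R) (g : R -> R) : a < 0 ->
  stepint l g a = 0.
Proof.
move=> a0; rewrite /stepint.
rewrite (@eq_Rintegral _ _ _ _ _ (fun=> 0)) ?Rintegral_cst ?mul0r// => x.
rewrite inE /= in_itv /= /step => /andP[x0 _].
by rewrite leNgt (lt_le_trans a0 x0)/= mul0r.
Qed.

Lemma stepint_gt {R : realType} (l a : R) (g : R -> R) : l <= a ->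
  stepint l g a = (\int[@lebesgue_measure R]_(x in `[0%R, l]) g x)%R.
Proof.
move=> la; apply: eq_Rintegral => x.
rewrite inE /= in_itv /= /step => /andP[_ xl].
by rewrite (le_trans xl la) mul1r.
Qed.

Definition clamp {R : realType} (l x : R) : R := Num.min l (Num.max 0 x).

Lemma clamp_itv {R : realType} (l x : R) : 0 <= l -> 0 <= clamp l x <= l.
Proof. by move=> l0; rewrite /clamp le_min ge_min le_max !lexx l0. Qed.

Lemma stepint_clamp {R : realType} (l a : R) (g : R -> R) : 0 <= l ->
  stepint l g a
    = (\int[@lebesgue_measure R]_(x in `[0%R, clamp l a]) g x)%R.
Proof.
move=> l0; have [a0|a0] := ltP a 0.
  rewrite stepint_lt0// /clamp (max_l (ltW a0)) (min_r l0).
  by rewrite set_itv1 Rintegral_set1.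
rewrite /clamp (max_r a0); have [la|al] := leP l a.
  by rewrite stepint_gt.
by rewrite stepint_in// a0 ltW.
Qed.

Lemma within_clamp {R : realType} (l : R) (F : R -> R) : 0 <= l ->
  {within `[0, l], continuous F} -> continuous (F \o clamp l).
Proof.
move=> l0 /subspace_continuousP Fc x.
have cl y : `[0, l]%classic (clamp l y) by rewrite /= in_itv/= clamp_itv.
have := Fc (clamp l x) (cl x) => {}Fc.
apply: (cvg_comp _ _ _ Fc) => B /= wB; rewrite /within/= in wB.
have cc : {for x, continuous (clamp l)}.
  apply: (continuous_min (f := cst l) (g := fun x : R => Num.max 0 x)).
    exact: cst_continuous.
  apply: (continuous_max (f := cst 0) (g := fun x : R => x)).
    exact: cst_continuous.
  exact: id.
have h : nbhs x (clamp l @^-1` [set z | z \in `[0, l] -> B z]) := cc _ wB.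
suff : nbhs x (clamp l @^-1` B) by [].
by apply: filterS h => y /=; apply; exact: cl.
Qed.

Lemma stepint_continuous {R : realType} (l : R) (g : R -> R) : 0 <= l ->
  intg l g -> continuous (stepint l g).
Proof.
move=> l0 ig.
rewrite (_ : stepint l g = (fun x => parameterized_integral
  (@lebesgue_measure R) 0 x g) \o clamp l); last first.
  by apply/funext => a; rewrite stepint_clamp.
by apply: within_clamp => //; exact: parameterized_integral_continuous.
Qed.

Lemma stepint_derive {R : realType} (l a : R) (g : R -> R) :
  intg l g -> 0 < a < l -> {for a, continuous g} ->
  is_derive a 1 (stepint l g) (g a).
Proof.
move=> ig /andP[a0 al] gc.
have [d e] := @continuous_FTC1_closed R g 0 a l al ig a0 gc.
have E : \near a, (\int[@lebesgue_measure R]_(t in `[0%R, a]) g t)%R = stepint l g a.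
  near=> x; rewrite stepint_in//; apply/andP; split; apply: ltW.
    by near: x; exact: lt_nbhsr.
  by near: x; exact: lt_nbhsl.
apply: (near_eq_is_derive E); rewrite -e derive1E.
exact/derivableP.
Unshelve. all: by end_near. Qed.

Lemma stepint_derive_out {R : realType} (l a : R) (g : R -> R) :
  a < 0 \/ l < a -> is_derive a 1 (stepint l g) 0.
Proof.
move=> H; pose c := stepint l g a.
have E : \near a, cst c a = stepint l g a.
  case: H => H; near=> x; rewrite /cst /c.
    rewrite !stepint_lt0//; near: x; exact: lt_nbhsl.
  rewrite !stepint_gt// ?(ltW H)//; apply: ltW.
  by near: x; exact: lt_nbhsr.
apply: (near_eq_is_derive E); exact: is_derive_cst.
Unshelve. all: by end_near. Qed.

(** * Derivative rules and the cosine equation *)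

Lemma is_derive_lin {R : realType} (f g : R -> R) (a b x df dg : R) :
  is_derive x 1 f df -> is_derive x 1 g dg ->
  is_derive x 1 (fun t => a * f t + b * g t) (a * df + b * dg).
Proof. by move=> hf hg; exact: is_deriveD. Qed.

Lemma is_derive_sq {R : realType} (f : R -> R) (x df : R) :
  is_derive x 1 f df -> is_derive x 1 (fun t => f t ^+ 2) (2 * f x * df).
Proof.
by move=> hf; apply: (is_derive_eq (is_deriveX 2 hf)); rewrite expr1.
Qed.

Lemma is_derive_affine {R : realType} (f : R -> R) (a b x df : R) :
  is_derive (a + b * x) 1 f df ->
  is_derive x 1 (fun t => f (a + b * t)) (df * b).
Proof.
move=> hf; apply: (@is_derive1_comp _ f (fun t => a + b * t)) => //.
have h : is_derive x 1 (fun t : R => 1 * cst a t + b * id t) (1 * 0 + b * 1).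
  exact: is_derive_lin.
rewrite (_ : (fun t => a + b * t) = (fun t : R => 1 * cst a t + b * id t)); last first.
  by apply/funext => t; rewrite mul1r.
by apply: (is_derive_eq h); rewrite mulr0 add0r mulr1.
Qed.

Lemma derive0_const {R : realType} (f : R -> R) (T : R) :
  {within `[0, T], continuous f} ->
  (forall t : R, 0 < t < T -> is_derive t 1 f 0) ->
  forall t : R, 0 <= t <= T -> f t = f 0.
Proof.
move=> fc f0 t /andP[t0 tT]; apply/eqP; rewrite -subr_eq0; apply/eqP.
have [z||c _ ->] := @MVT_segment R f (fun=> 0) 0 t t0; last by rewrite mul0r.
  rewrite in_itv/= => /andP[z0 zt]; apply: f0; rewrite z0; exact: lt_le_trans tT.
apply: continuous_subspaceW fc; apply: subset_itvl; rewrite bnd_simp//.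
Qed.

(** The equation [U'' = - k ^ 2 U] with [U 0 = U0] and [U' 0 = 0], stated for its first and second
    integrals [Y] and [W]: these are differentiable when the eigenfunction is only known to be
    continuous. *)
Lemma cosine_ode {R : realType} (T k U0 : R) (Y W : R -> R) :
  continuous Y -> continuous W -> Y 0 = 0 -> W 0 = 0 ->
  (forall t : R, 0 < t < T -> is_derive t 1 W (Y t)) ->
  (forall t : R, 0 < t < T -> is_derive t 1 Y (U0 - k ^+ 2 * W t)) ->
  forall t : R, 0 <= t <= T ->
    Y t ^+ 2 = (U0 * t) ^+ 2 * sinc2 (t * k) /\
    k ^+ 2 * W t = U0 * (1 - cos (t * k)).
Proof.
move=> Yc Wc Y0 W0 dW dY t tT.
pose C s := U0 * (1 - cos (0 + k * s)).
pose A s := k * Y s + (- U0) * sin (0 + k * s).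
pose B s := k ^+ 2 * W s + (-1) * C s.
have kc : continuous (fun s : R => 0 + k * s).
  by move=> s; apply: cvgD; [exact: cvg_cst|apply: cvgMr; exact: cvg_id].
have sc : continuous (fun s : R => sin (0 + k * s)).
  by move=> s; apply: continuous_comp; [exact: kc|exact: continuous_sin].
have cc : continuous (fun s : R => cos (0 + k * s)).
  by move=> s; apply: continuous_comp; [exact: kc|exact: continuous_cos].
have Ac : continuous A.
  by move=> s; apply: cvgD; apply: cvgMr; [exact: Yc|exact: sc].
have Bc : continuous B.
  move=> s; apply: cvgD; apply: cvgMr; first exact: Wc.
  by apply: cvgMr; apply: cvgB; [exact: cvg_cst|exact: cc].
have dsin (s : R) : is_derive s (1 : R) (fun s : R => sin (0 + k * s)) (cos (0 + k * s) * k).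
  by apply: is_derive_affine; exact: is_derive_sin.
have dC (s : R) : is_derive s 1 C (U0 * (sin (0 + k * s) * k)).
  have h : is_derive s 1 (fun s : R => U0 * cst 1 s + (- U0) * cos (0 + k * s))
      (U0 * 0 + (- U0) * (- sin (0 + k * s) * k)).
    apply: is_derive_lin.
    by apply: is_derive_affine; exact: is_derive_cos.
  rewrite (_ : C = (fun s : R => U0 * cst 1 s + (- U0) * cos (0 + k * s))).
    by apply: (is_derive_eq h); ring.
  by apply/funext => z; rewrite /C /cst; ring.
(* [A' = - k B] and [B' = k A], so that the energy [E] is constant. *)
pose E s := A s ^+ 2 + B s ^+ 2.
have E0 (s : R) : 0 <= s <= T -> E s = E 0.
  apply: derive0_const.
    apply: continuous_subspaceT => z.
    apply: cvgD; [exact: (cvgM (Ac z) (Ac z))|exact: (cvgM (Bc z) (Bc z))].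
  move=> z zT.
  have dA : is_derive z 1 A (- k * B z).
    have h := is_derive_lin _ _ k (- U0) _ _ _ (dY z zT) (dsin z).
    by apply: (is_derive_eq h); rewrite /B /C; ring.
  have dB : is_derive z 1 B (k * A z).
    have h := is_derive_lin _ _ (k ^+ 2) (-1) _ _ _ (dW z zT) (dC z).
    by apply: (is_derive_eq h); rewrite /A; ring.
  have h := is_derive_lin _ _ 1 1 _ _ _ (is_derive_sq _ _ _ dA) (is_derive_sq _ _ _ dB).
  rewrite (_ : E = (fun t => 1 * A t ^+ 2 + 1 * B t ^+ 2)).
    by apply: (is_derive_eq h); ring.
  by apply/funext => s'; rewrite !mul1r.
have EE : E t = 0.
  rewrite E0// /E /A /B /C Y0 W0 !mulr0 addr0 sin0 cos0 subrr.
  by rewrite !mulr0 addr0 expr0n addr0.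
have [A0 B0] : A t = 0 /\ B t = 0.
  move: EE => /eqP; rewrite /E paddr_eq0 ?sqr_ge0//.
  by rewrite !sqrf_eq0 => /andP[/eqP ? /eqP ?].
move: A0 B0; rewrite /A /B /C !add0r => A0 B0.
have kY : k * Y t = U0 * sin (t * k).
  by apply/eqP; rewrite -subr_eq0 (mulrC t) -mulNr A0.
have kW : k ^+ 2 * W t = U0 * (1 - cos (t * k)).
  by apply/eqP; rewrite -subr_eq0 (mulrC t) -mulN1r B0.
split => //.
(* For [k = 0], the eigenvalue of the constants, the identity for [k * Y] is void. Then [Y' = U0]
   directly, which matches the value 1 of [sinc2] at 0. *)
have [k0|kN0] := eqVneq k 0; last first.
  apply: (@mulfI _ (k ^+ 2)); first by rewrite expf_neq0.
  by rewrite -exprMn kY exprMn -sinc2_sqr; ring.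
have : Y t - U0 * t = Y 0 - U0 * 0.
  apply: (derive0_const (fun t => Y t - U0 * t)) tT.
    apply: continuous_subspaceT => z.
    by apply: cvgB; [exact: Yc|apply: cvgMr; exact: cvg_id].
  move=> s sT.
  have h := is_derive_lin _ _ 1 (- U0) _ _ _ (dY s sT) (is_derive_id s 1).
  rewrite (_ : (fun t => Y t - U0 * t) = (fun t => 1 * Y t + (- U0) * id t)).
    by apply: (is_derive_eq h); rewrite k0; ring.
  by apply/funext => z; rewrite mul1r mulNr.
rewrite Y0 mulr0 subrr => /eqP; rewrite subr_eq0 => /eqP ->.
by rewrite k0 mulr0 /sinc2 eqxx mulr1.
Qed.

(** * Ramp integrals *)

Lemma intg_continuous {R : realType} (l : R) (g : R -> R) :
  continuous g -> intg l g.
Proof.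
move=> gc; apply: continuous_compact_integrable; first exact: segment_compact.
exact: continuous_subspaceT.
Qed.

Definition rampint {R : realType} (l : R) (g : R -> R) (a : R) : R :=
  (\int[@lebesgue_measure R]_(x in `[0%R, l]) (ramp a x * g x))%R.

Lemma continuous_idM {R : realType} (g : R -> R) :
  continuous g -> continuous (fun x : R => x * g x).
Proof. by move=> gc x; apply: cvgM; [exact: cvg_id|exact: gc]. Qed.

Lemma rampintE {R : realType} (l a : R) (g : R -> R) : continuous g ->
  rampint l g a = a * stepint l g a - stepint l (fun x => x * g x) a.
Proof.
move=> gc; have ig := intg_step _ a _ (intg_continuous l _ gc).
have ixg := intg_step _ a _ (intg_continuous l _ (continuous_idM _ gc)).
rewrite /rampint /stepint -RintegralZl// -RintegralB//; last first.
  exact: (integrableZl _ a ig).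
by apply: eq_Rintegral => x _; rewrite ramp_step; ring.
Qed.

Lemma rampint_continuous {R : realType} (l : R) (g : R -> R) : 0 <= l ->
  continuous g -> continuous (rampint l g).
Proof.
move=> l0 gc; rewrite (_ : rampint l g = fun a => a * stepint l g a -
    stepint l (fun x => x * g x) a); last by apply/funext => a; exact: rampintE.
move=> a; apply: cvgB.
  apply: cvgM; first exact: cvg_id.
  by apply: stepint_continuous => //; exact: intg_continuous.
apply: stepint_continuous => //; apply: intg_continuous.
exact: continuous_idM.
Qed.

Lemma rampint_derive {R : realType} (l a : R) (g : R -> R) : continuous g ->
  a < 0 \/ 0 < a < l \/ l < a ->
  is_derive a 1 (rampint l g) (stepint l g a).
Proof.
move=> gc H.
(* [z] is [g a] inside the interval and 0 outside. In the derivative of [rampintE] the two terms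
   [a * z] cancel, and only [stepint l g a] remains. *)
have [z [h1 h2]] : exists z, is_derive a 1 (stepint l g) z /\
   is_derive a 1 (stepint l (fun x => x * g x)) (a * z).
  case: H => [H|[H|H]].
  - by exists 0; rewrite mulr0; split; apply: stepint_derive_out; left.
  - exists (g a); split; apply: stepint_derive H _.
    + exact: intg_continuous.
    + exact: gc.
    + by apply: intg_continuous; exact: continuous_idM.
    + exact: continuous_idM.
  - by exists 0; rewrite mulr0; split; apply: stepint_derive_out; right.
rewrite (_ : rampint l g = id * stepint l g - stepint l (fun x => x * g x)); last first.
  by apply/funext => b; exact: rampintE.
have h := is_deriveB (is_deriveM (is_derive_id a 1) h1) h2.
by apply: (is_derive_eq h); rewrite /GRing.scale/=; ring.
Qed.

Lemma stepint_cst {R : realType} (l a : R) : 0 <= l ->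
  stepint l (fun=> 1) a = clamp l a.
Proof.
move=> l0; rewrite stepint_clamp// Rintegral_cst//= mul1r.
have /andP[c0 cl] := clamp_itv l a l0.
rewrite lebesgue_measure_itv/= lte_fin; case: ltP => c; first by rewrite -EFinB subr0.
by apply/eqP; rewrite eq_sym eq_le c0 c.
Qed.

Lemma ramp_primitive {R : realType} (a x : R) : 0 <= x ->
  ramp a x = ramp a 0 - (\int[@lebesgue_measure R]_(t in `[0%R, x]) step a t)%R.
Proof.
move=> x0; have := stepint_cst x a x0; rewrite /stepint.
under eq_Rintegral do rewrite mulr1.
move=> ->; rewrite /ramp /clamp subr0.
have [a0|a0] := leP 0 a; have [xa|xa] := leP 0 (a - x);
  have [q|q] := leP x 0; have [p|p] := leP x a; lra.
Qed.

(** * Square-integrable functions on an interval *)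

Definition L2on {R : realType} (l : R) (f : R -> R) : Prop :=
  (f \_ `[0%R, l]) \in Lfun (@lebesgue_measure R) 2%:E.

Lemma L2on_mul {R : realType} (l : R) (f g : R -> R) :
  L2on l f -> L2on l g -> intg l (fun x => f x * g x).
Proof.
move=> hf hg; have /Lfun1_integrable := Lfun2_mul_Lfun1 hf hg.
move=> h; rewrite /intg integrable_mkcond//; move: h; congr (integrable _ _ _).
apply/funext => x; rewrite /= !patchE.
by case: ifP => // _; rewrite mul0r.
Qed.

Lemma L2on_bounded {R : realType} (l M : R) (f : R -> R) :
  measurable_fun `[0%R, l] f -> (forall x, 0 <= x <= l -> `|f x| <= M) ->
  L2on l f.
Proof.
move=> mf fM; rewrite /L2on inE; apply/andP; split; rewrite inE/=.
  by apply/(measurable_restrictT _ _).1.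
rewrite /finite_norm unlock /Lnorm poweR_lty//.
apply: integrable_lty => //.
rewrite (_ : (fun x => _) = (EFin \o (fun x => f x ^+ 2)) \_ `[0, l]); last first.
  apply/funext => x; rewrite /= !patchE; case: ifP => _.
    by rewrite /= powR_mulrn// real_normK ?num_real.
  by rewrite /point/= normr0 powR0.
rewrite -integrable_mkcond//; apply: measurable_bounded_integrable => //.
- by rewrite /= lebesgue_measure_itv/=; case: ifP => // _; rewrite -EFinB ltry.
- exact: measurable_funX.
- exists (M ^+ 2); split; first exact: num_real.
  move=> K MK x; rewrite /= in_itv/= => xl.
  apply: le_trans (ltW MK); rewrite normrX lerXn2r ?nnegrE//.
    exact: le_trans (normr_ge0 _) (fM x xl).
  exact: fM.
Qed.

Lemma L2on_continuous {R : realType} (l : R) (f : R -> R) : 0 <= l ->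
  continuous f -> L2on l f.
Proof.
move=> l0 fc; have cn : {within `[0, l], continuous (fun x => `|f x|)}.
  apply: continuous_subspaceT => x; exact: (cvg_norm (fc x)).
have [c _ cM] := EVT_max l0 cn.
apply: (L2on_bounded _ `|f c|) => [|x xl]; last by apply: cM; rewrite in_itv.
by apply: measurable_funTS; exact: continuous_measurable_fun.
Qed.

Lemma L2on_step {R : realType} (l a : R) : L2on l (step a).
Proof.
apply: (L2on_bounded _ 1) => [|x _]; first exact: measurable_step.
by rewrite /step; case: (x <= a)%R; rewrite ?normr1 ?normr0.
Qed.

Lemma L2on_intg {R : realType} (l : R) (f : R -> R) : L2on l f -> intg l f.
Proof.
move=> hf; have h1 : L2on l (fun=> 1).
  by apply: (L2on_bounded _ 1) => // x _; rewrite normr1.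
have := L2on_mul _ _ _ hf h1.
by congr (integrable _ _ _); apply/funext => x; rewrite /= mulr1.
Qed.

Lemma L2on_lin {R : realType} (l a b : R) (f g : R -> R) :
  L2on l f -> L2on l g -> L2on l (fun x => a * f x + b * g x).
Proof.
have [H0 H] := @Lfun_submod_closed _ _ _ (@lebesgue_measure R) 2%:E (lee1n 2).
move=> hf hg; have hbg := H b _ _ hg H0; have := H a _ _ hf hbg.
rewrite /L2on => h; rewrite (_ : _ \_ _ =
  a *: (f \_ `[0%R, l]) + (b *: (g \_ `[0%R, l]) + 0))//.
apply/funext => x; rewrite addr0.
rewrite -[RHS]/(a *: (f \_ `[0%R, l]) x + b *: (g \_ `[0%R, l]) x).
rewrite !patchE; case: ifP => //.
by rewrite /point/= !scaler0 addr0.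
Qed.

(** * Stars about a point of the graph *)

Lemma is_derive_big {R : realType} {I : Type} (r : seq I) (F : I -> R -> R)
    (dF : I -> R) (x : R) :
  (forall i, is_derive x 1 (F i) (dF i)) ->
  is_derive x 1 (fun t => \sum_(i <- r) F i t) (\sum_(i <- r) dF i).
Proof.
move=> h; elim: r => [|i r IH].
  rewrite big_nil; under eq_fun do rewrite big_nil; exact: is_derive_cst.
rewrite big_cons; under eq_fun do rewrite big_cons.
exact: is_deriveD (h i) IH.
Qed.

Lemma is_derive_big_in {R : realType} {I : eqType} (r : seq I) (F : I -> R -> R)
    (dF : I -> R) (x : R) :
  (forall i, i \in r -> is_derive x 1 (F i) (dF i)) ->
  is_derive x 1 (fun t => \sum_(i <- r) F i t) (\sum_(i <- r) dF i).
Proof.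
elim: r => [|i r IH] h.
  rewrite big_nil; under eq_fun do rewrite big_nil; exact: is_derive_cst.
rewrite big_cons; under eq_fun do rewrite big_cons.
apply: is_deriveD; first by apply: h; rewrite mem_head.
by apply: IH => j jr; apply: h; rewrite inE jr orbT.
Qed.

Lemma continuous_big {R : realType} {I : Type} (r : seq I) (F : I -> R -> R) :
  (forall i, continuous (F i)) -> continuous (fun t => \sum_(i <- r) F i t).
Proof.
move=> h; elim: r => [|i r IH] x.
  by under eq_fun do rewrite big_nil; exact: cst_continuous.
under eq_fun do rewrite big_cons.
exact: cvgD (h i x) (IH x).
Qed.

Lemma intg_big {R : realType} {I : Type} (l : R) (r : seq I) (F : I -> R -> R) :
  (forall i, intg l (F i)) -> intg l (fun x => \sum_(i <- r) F i x).
Proof.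
move=> h; rewrite /intg.
rewrite (_ : EFin \o _ = fun x => (\sum_(i <- r) (F i x)%:E)%E); last first.
  by apply/funext => x; rewrite /= sumEFin.
by apply: integrable_sum => // i _; exact: h.
Qed.

Lemma Rintegral_big {R : realType} {I : Type} (l : R) (r : seq I)
    (F : I -> R -> R) : (forall i, intg l (F i)) ->
  (\int[@lebesgue_measure R]_(x in `[0%R, l]) \sum_(i <- r) F i x)%R
   = \sum_(i <- r) (\int[@lebesgue_measure R]_(x in `[0%R, l]) F i x)%R.
Proof.
move=> h; elim: r => [|i r IH].
  rewrite big_nil; under eq_Rintegral do rewrite big_nil.
  by rewrite Rintegral_cst// mul0r.
rewrite big_cons -IH -RintegralD//; last 2 first.
- exact: h.
- exact: intg_big.
by apply: eq_Rintegral => x _; rewrite big_cons.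
Qed.

(** This is [max 0 (t - |x - c|)], written with ramps so that integrating against it gives values of
    [rampint], whose derivatives are known. *)
Definition tent {R : realType} (t c x : R) : R :=
  ramp (c + t) x + ramp (c - t) x - 2 * ramp c x.

Definition dtent {R : realType} (t c x : R) : R :=
  2 * step c x - step (c + t) x - step (c - t) x.

(* The indicator of the half-open interval ]c - t, c + t]: half-open so that
   the balls about the two ends of an edge are disjoint without exception. *)
Definition ball_ind {R : realType} (t c x : R) : R :=
  step (c + t) x - step (c - t) x.

Lemma ramp_continuous {R : realType} (a : R) : continuous (ramp a).
Proof.
move=> x; apply: (continuous_max (f := cst 0) (g := fun x : R => a - x)).
  exact: cst_continuous.
by apply: cvgB; [exact: cvg_cst|exact: cvg_id].
Qed.

Lemma tent_continuous {R : realType} (t c : R) : continuous (tent t c).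
Proof.
move=> x; apply: cvgB; last by apply: cvgMr; exact: ramp_continuous.
by apply: cvgD; exact: ramp_continuous.
Qed.

Lemma L2on_dtent {R : realType} (l t c : R) : L2on l (dtent t c).
Proof.
have h := L2on_lin l 2 (-1) _ _ (L2on_step l c) (L2on_step l (c + t)).
have := L2on_lin l 1 (-1) _ _ h (L2on_step l (c - t)).
congr (L2on l _); apply/funext => x; rewrite /dtent; ring.
Qed.

Lemma L2on_ball {R : realType} (l t c : R) : L2on l (ball_ind t c).
Proof.
have := L2on_lin l 1 (-1) _ _ (L2on_step l (c + t)) (L2on_step l (c - t)).
congr (L2on l _); apply/funext => x; rewrite /ball_ind; ring.
Qed.

Lemma L2on_big {R : realType} {I : Type} (l : R) (r : seq I) (F : I -> R -> R) :
  (forall i, L2on l (F i)) -> L2on l (fun x => \sum_(i <- r) F i x).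
Proof.
move=> h; elim: r => [|i r IH].
  have -> : (fun x => \sum_(i <- [::]) F i x) = cst 0.
    by apply/funext => x; rewrite big_nil.
  by apply: (L2on_bounded _ 0) => // x _; rewrite normr0.
have := L2on_lin l 1 1 _ _ (h i) IH.
by congr (L2on l _); apply/funext => x; rewrite big_cons !mul1r.
Qed.

Lemma intg_lin {R : realType} (l a b : R) (f g : R -> R) :
  intg l f -> intg l g -> intg l (fun x => a * f x + b * g x).
Proof.
move=> hf hg; have h1 : intg l (fun x => a * f x) by exact: integrableZl hf.
have h2 : intg l (fun x => b * g x) by exact: integrableZl hg.
exact: integrableD h1 h2.
Qed.

Lemma Rintegral_lin {R : realType} (l a b : R) (f g : R -> R) :
  intg l f -> intg l g ->
  (\int[@lebesgue_measure R]_(x in `[0%R, l]) (a * f x + b * g x))%R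
  = a * (\int[@lebesgue_measure R]_(x in `[0%R, l]) f x)%R
    + b * (\int[@lebesgue_measure R]_(x in `[0%R, l]) g x)%R.
Proof.
move=> hf hg; have h1 : intg l (fun x => a * f x) by exact: integrableZl hf.
have h2 : intg l (fun x => b * g x) by exact: integrableZl hg.
by rewrite RintegralD// !RintegralZl.
Qed.

Lemma int_dtent {R : realType} (l t c : R) (g : R -> R) : intg l g ->
  (\int[@lebesgue_measure R]_(x in `[0%R, l]) (g x * dtent t c x))%R
    = 2 * stepint l g c - stepint l g (c + t) - stepint l g (c - t).
Proof.
move=> ig; have ia a := intg_step _ a _ ig.
have h := Rintegral_lin l 1 (-1) _ _
  (intg_lin l 2 (-1) _ _ (ia c) (ia (c + t))) (ia (c - t)).
transitivity (1 * (2 * stepint l g c + -1 * stepint l g (c + t))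
  + -1 * stepint l g (c - t)); last by ring.
rewrite /stepint -(Rintegral_lin _ 2 (-1) _ _ (ia c) (ia (c + t))) -h.
by apply: eq_Rintegral => x _; rewrite /dtent; ring.
Qed.

Lemma int_ball {R : realType} (l t c : R) (g : R -> R) : intg l g ->
  (\int[@lebesgue_measure R]_(x in `[0%R, l]) (ball_ind t c x * g x))%R
    = stepint l g (c + t) - stepint l g (c - t).
Proof.
move=> ig; have ia a := intg_step _ a _ ig.
have h := Rintegral_lin l 1 (-1) _ _ (ia (c + t)) (ia (c - t)).
transitivity (1 * stepint l g (c + t) + -1 * stepint l g (c - t)); last by ring.
by rewrite -h; apply: eq_Rintegral => x _; rewrite /ball_ind; ring.
Qed.

Lemma int_tent {R : realType} (l t c : R) (g : R -> R) : continuous g ->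
  (\int[@lebesgue_measure R]_(x in `[0%R, l]) (g x * tent t c x))%R
    = rampint l g (c + t) + rampint l g (c - t) - 2 * rampint l g c.
Proof.
move=> gc.
have ir a : intg l (fun x => ramp a x * g x).
  apply: intg_continuous => x.
  by apply: cvgM; [exact: ramp_continuous|exact: gc].
have h := Rintegral_lin l 1 (-2) _ _
  (intg_lin l 1 1 _ _ (ir (c + t)) (ir (c - t))) (ir c).
transitivity (1 * (1 * rampint l g (c + t) + 1 * rampint l g (c - t))
  + -2 * rampint l g c); last by ring.
rewrite /rampint -(Rintegral_lin _ 1 1 _ _ (ir (c + t)) (ir (c - t))) -h.
by apply: eq_Rintegral => x _; rewrite /tent; ring.
Qed.

Lemma tent_primitive {R : realType} (t c x : R) : 0 <= x ->
  tent t c x = tent t c 0 +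
    (\int[@lebesgue_measure R]_(s in `[0%R, x]) dtent t c s)%R.
Proof.
move=> x0.
have i1 : intg x (fun=> 1) by apply: intg_continuous => z; exact: cvg_cst.
have := int_dtent x t c _ i1; under eq_Rintegral do rewrite mul1r.
have E a : stepint x (fun=> 1) a = ramp a 0 - ramp a x.
  rewrite (ramp_primitive _ _ x0) opprB addrC subrK /stepint.
  by apply: eq_Rintegral => z _; rewrite mulr1.
by rewrite !E /tent => ->; ring.
Qed.

(** * Functions on the graph, read on its edges *)

Lemma edge_point_le0 {R : realType} {G : metricGraph R} (e : edge G) (x : R) :
  x <= 0 -> edge_point e x = Vertex (src e).
Proof. by rewrite /edge_point => ->. Qed.

Lemma edge_point_ge {R : realType} {G : metricGraph R} (e : edge G) (x : R) :
  len e <= x -> edge_point e x = Vertex (tgt e).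
Proof.
move=> lx; rewrite /edge_point leNgt (lt_le_trans (len_gt0 e) lx)/=.
by case: insubP => [[y yl] /= /andP[_]|//]; rewrite ltNge lx.
Qed.

Lemma edge_point_val {R : realType} {G : metricGraph R} (e : edge G)
  (x : {x : R | 0 < x < len e}) : edge_point e (val x) = @Interior R G e x.
Proof.
have /andP[x0 _] := valP x; rewrite /edge_point leNgt x0/=.
by rewrite valK.
Qed.

Lemma edge_point_clamp {R : realType} {G : metricGraph R} (e : edge G) (x : R) :
  edge_point e (clamp (len e) x) = edge_point e x.
Proof.
have l0 := ltW (len_gt0 e).
rewrite /clamp; have [x0|x0] := leP 0 x; last first.
  by rewrite (min_r l0) !edge_point_le0// ltW.
have [lx|//] := leP (len e) x.
by rewrite !edge_point_ge.
Qed.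

Lemma H1_deriv_stepint {R : realType} {G : metricGraph R} (u : gpoint G -> R)
    (du : edge_family G) (e : edge G) (a : R) : H1_deriv u du ->
  on_edges u e a = on_edges u e 0 + stepint (len e) (du e) a.
Proof.
move=> [_ H]; have l0 := ltW (len_gt0 e).
by rewrite stepint_clamp// -H ?clamp_itv// /on_edges edge_point_clamp.
Qed.

Lemma H1_deriv_intg {R : realType} {G : metricGraph R} (u : gpoint G -> R)
    (du : edge_family G) (e : edge G) : H1_deriv u du -> intg (len e) (du e).
Proof. by move=> [H _]; apply: L2on_intg; exact: H. Qed.

Lemma H1_deriv_continuous {R : realType} {G : metricGraph R}
    (u : gpoint G -> R) (du : edge_family G) (e : edge G) :
  H1_deriv u du -> continuous (on_edges u e).
Proof.
move=> H; rewrite (_ : on_edges u e =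
    fun a => on_edges u e 0 + stepint (len e) (du e) a); last first.
  by apply/funext => a; exact: H1_deriv_stepint.
move=> a; apply: cvgD; first exact: cvg_cst.
apply: stepint_continuous; first exact: ltW (len_gt0 e).
exact: H1_deriv_intg H.
Qed.

Lemma glue_edges {R : realType} {G : metricGraph R} (F : edge G -> R -> R)
    (val : vertex G -> R) :
  (forall e, F e 0 = val (src e) /\ F e (len e) = val (tgt e)) ->
  exists v : gpoint G -> R,
    forall e x, 0 <= x <= len e -> on_edges v e x = F e x.
Proof.
move=> hF; exists (fun p => match p with
  | Vertex w => val w
  | Interior e x => F e (sval x) end) => e x /andP[x0 xl]; rewrite /on_edges.
have [xp|xn] := ltP 0 x; last first.
  by rewrite edge_point_le0//= -(hF e).1 (@le_anti _ _ x 0)// xn x0.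
have [xl'|lx] := ltP x (len e); last first.
  by rewrite edge_point_ge//= -(hF e).2 (@le_anti _ _ x (len e))// xl lx.
have h : 0 < x < len e by rewrite xp.
by rewrite -[x]/(sval (exist (fun y => 0 < y < len e) x h)) edge_point_val.
Qed.

(* [cen e] lists the positions of [q] on the closed edge [e], and [T] is a
   radius for which the balls about them neither overlap nor reach another
   vertex.  In [star_ball], [t = T] is excluded: the half-open ball could then
   contain the far end of the edge.  In [star_degree], a position counts once
   for each direction in which the edge leaves it. *)
Record star {R : realType} {G : metricGraph R} (q : gpoint G) (T : R)
    (cen : edge G -> seq R) : Prop := Star {
  star_T_gt0 : 0 < T;
  star_at : forall e c, c \in cen e -> 0 <= c <= len e /\ edge_point e c = q;
  star_left : forall e c, c \in cen e -> c = 0 \/ T <= c;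
  star_right : forall e c, c \in cen e -> c = len e \/ c + T <= len e;
  star_disjoint : forall e t x, 0 < t <= T ->
    (\sum_(c <- cen e) ball_ind t c x) ^+ 2 = \sum_(c <- cen e) ball_ind t c x;
  star_tent : forall t, 0 < t <= T -> exists v : gpoint G -> R,
    forall e x, 0 <= x <= len e ->
      on_edges v e x = \sum_(c <- cen e) tent t c x;
  star_ball : forall t, 0 < t < T -> exists v : gpoint G -> R,
    forall e x, 0 <= x <= len e ->
      on_edges v e x = \sum_(c <- cen e) ball_ind t c x;
  star_degree : (degree q)%:R =
    \sum_(e : edge G) \sum_(c <- cen e) ((c != 0)%:R + (c != len e)%:R) :> R }.

Definition star_sum {R : realType} {G : metricGraph R} (cen : edge G -> seq R)
    (F : edge G -> R -> R) : R := \sum_(e : edge G) \sum_(c <- cen e) F e c.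

(** The weak equation is tested on the tent about [q], whose slopes are 1 and -1, so the form
    becomes a second difference of [u]. At a vertex this one test function carries the balance of
    the outward derivatives. *)
Lemma star_tent_weak {R : realType} {G : metricGraph R} (q : gpoint G) (T : R)
    (cen : edge G -> seq R) (u : gpoint G -> R) (du : edge_family G)
    (lam t : R) :
  star q T cen -> 0 < t <= T -> H1_deriv u du ->
  (forall v dv, H1_deriv v dv ->
    inner du dv = inner (on_edges (fun p => lam * u p)) (on_edges v)) ->
  star_sum cen (fun e c => 2 * on_edges u e c - on_edges u e (c + t)
     - on_edges u e (c - t))
  = lam * star_sum cen (fun e c => rampint (len e) (on_edges u e) (c + t)
     + rampint (len e) (on_edges u e) (c - t)
     - 2 * rampint (len e) (on_edges u e) c).
Proof.
move=> st tT Hu weak; have [v vE] := star_tent _ _ _ st t tT.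
pose dv : edge_family G := fun e x => \sum_(c <- cen e) dtent t c x.
have dvL2 : in_L2 dv by move=> e; apply: L2on_big => c; exact: L2on_dtent.
have Hv : H1_deriv v dv.
  split=> // e x /[dup] xl /andP[x0 _].
  rewrite !vE ?lexx ?(ltW (len_gt0 e))//.
  rewrite Rintegral_big; last by move=> c; exact/L2on_intg/L2on_dtent.
  by rewrite -big_split/=; apply: eq_bigr => c _; exact: tent_primitive.
have uc e := H1_deriv_continuous _ _ e Hu.
have ui e := H1_deriv_intg _ _ e Hu.
have := weak v dv Hv; rewrite /inner /star_sum mulr_sumr => E.
transitivity (\sum_(e : edge G)
    (\int[@lebesgue_measure R]_(x in `[0%R, len e]) (du e x * dv e x))%R).
  apply: eq_bigr => e _; rewrite /dv.
  under eq_Rintegral do rewrite mulr_sumr.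
  rewrite Rintegral_big; last first.
    by move=> c; apply: L2on_mul; [exact: Hu.1|exact: L2on_dtent].
  apply: eq_bigr => c _; rewrite int_dtent//.
  rewrite (H1_deriv_stepint _ _ e c Hu) (H1_deriv_stepint _ _ e (c + t) Hu).
  by rewrite (H1_deriv_stepint _ _ e (c - t) Hu); ring.
rewrite E; apply: eq_bigr => e _.
transitivity (\int[@lebesgue_measure R]_(x in `[0%R, len e])
    \sum_(c <- cen e) lam * (on_edges u e x * tent t c x))%R.
  apply: eq_Rintegral => x; rewrite inE/= in_itv/= => xl.
  by rewrite vE// mulr_sumr; apply: eq_bigr => c _; rewrite /on_edges mulrA.
have ut c : intg (len e) (fun x => on_edges u e x * tent t c x).
  apply: intg_continuous => x.
  by apply: cvgM; [exact: uc|exact: tent_continuous].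
rewrite Rintegral_big; last by move=> c; exact: integrableZl (ut c).
rewrite mulr_sumr; apply: eq_bigr => c _.
by rewrite RintegralZl//; [rewrite int_tent|exact: ut].
Qed.

(** * Local Parseval identity *)

Lemma star_eigen {R : realType} {G : metricGraph R} (q : gpoint G) (T : R)
    (cen : edge G -> seq R) (u : gpoint G -> R) (du : edge_family G) (k t : R) :
  star q T cen -> H1_deriv u du ->
  (forall v dv, H1_deriv v dv ->
    inner du dv = inner (on_edges (fun p => k ^+ 2 * u p)) (on_edges v)) ->
  0 <= t <= T ->
  star_sum cen (fun e c => stepint (len e) (on_edges u e) (c + t)
     - stepint (len e) (on_edges u e) (c - t)) ^+ 2
    = ((degree q)%:R * u q * t) ^+ 2 * sinc2 (t * k) /\
  star_sum cen (fun e c => 2 * on_edges u e c - on_edges u e (c + t)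
     - on_edges u e (c - t)) = (degree q)%:R * u q * (1 - cos (t * k)).
Proof.
move=> st Hu weak tT.
have uc e := H1_deriv_continuous _ _ e Hu.
have ui e : intg (len e) (on_edges u e) by exact: intg_continuous.
have l0 (e : edge G) := ltW (len_gt0 e).
pose P e := stepint (len e) (on_edges u e).
pose PP e := rampint (len e) (on_edges u e).
(* [Y s] is the integral of [u] over the ball of radius [s], and [W s] its integral against the
   tent. Then [W' = Y], while [Y'] is the sum of [u] over the points at distance [s], which the weak
   equation expresses by [W s]. *)
pose Y s := star_sum cen (fun e c => 1 * P e (c + 1 * s) + (-1) * P e (c + (-1) * s)).
pose W s := star_sum cen (fun e c =>
   1 * (1 * PP e (c + 1 * s) + 1 * PP e (c + (-1) * s)) + (-2) * PP e c).
have Pc e : continuous (P e) by apply: stepint_continuous.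
have PPc e : continuous (PP e) by apply: rampint_continuous.
have aff (F : R -> R) (c b : R) : continuous F ->
    continuous (fun s : R => F (c + b * s)).
  move=> Fc s; apply: (@continuous_comp _ _ _ (fun s : R => c + b * s) F s); last exact: Fc.
  by apply: cvgD; [exact: cvg_cst|apply: cvgMr; exact: cvg_id].
have Yc : continuous Y.
  apply: continuous_big => e; apply: continuous_big => c s.
  by apply: cvgD; apply: cvgMr; exact: aff.
have Wc : continuous W.
  apply: continuous_big => e; apply: continuous_big => c s.
  apply: cvgD; last exact: cvg_cst.
  by apply: cvgMr; apply: cvgD; apply: cvgMr; exact: aff.
have Y0 : Y 0 = 0.
  rewrite /Y /star_sum big1// => e _; rewrite big1// => c _.
  by rewrite !mulr0 !addr0; ring.
have W0 : W 0 = 0.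
  rewrite /W /star_sum big1// => e _; rewrite big1// => c _.
  by rewrite !mulr0 !addr0; ring.
have dW s : 0 < s < T -> is_derive s (1 : R) W (Y s).
  move=> /andP[s0 sT].
  rewrite /Y /star_sum; apply: is_derive_big => e; apply: is_derive_big_in => c ce.
  have [/andP[c0 cl] _] := star_at _ _ _ st _ _ ce.
  have d1 : is_derive s (1 : R) (fun s => PP e (c + 1 * s)) (P e (c + 1 * s) * 1).
    apply: is_derive_affine; apply: rampint_derive => //.
    right; have [->|cT] := star_right _ _ _ st _ _ ce.
      by right; rewrite mul1r ltrDl.
    by left; apply/andP; split; rewrite mul1r; lra.
  have d2 : is_derive s (1 : R) (fun s => PP e (c + (-1) * s)) (P e (c + (-1) * s) * (-1)).
    apply: is_derive_affine; apply: rampint_derive => //.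
    have [->|cT] := star_left _ _ _ st _ _ ce.
      by left; rewrite mulN1r; lra.
    by right; left; apply/andP; split; rewrite mulN1r; lra.
  have d3 := is_derive_lin _ _ 1 1 _ _ _ d1 d2.
  have d4 := is_derive_lin _ _ 1 (-2) _ _ _ d3 (is_derive_cst (PP e c) s 1).
  by apply: (is_derive_eq d4); ring.
have weakW s : 0 < s <= T ->
    star_sum cen (fun e c => 2 * on_edges u e c - on_edges u e (c + s)
     - on_edges u e (c - s)) = k ^+ 2 * W s.
  move=> sT; rewrite (star_tent_weak _ _ _ _ _ _ _ st sT Hu weak); congr (_ * _).
  apply: eq_bigr => e _; apply: eq_bigr => c _.
  by rewrite !mul1r mulN1r /PP; ring.
have uq e c : c \in cen e -> on_edges u e c = u q.
  by move=> ce; rewrite /on_edges (star_at _ _ _ st _ _ ce).2.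
have dY s : 0 < s < T ->
    is_derive s (1 : R) Y ((degree q)%:R * u q - k ^+ 2 * W s).
  move=> /andP[s0 sT].
  have -> : (degree q)%:R * u q - k ^+ 2 * W s = star_sum cen (fun e c =>
      ((c != 0)%:R + (c != len e)%:R) * u q - (2 * on_edges u e c
        - on_edges u e (c + s) - on_edges u e (c - s))).
    rewrite -weakW ?s0 ?ltW// (star_degree _ _ _ st) mulr_suml /star_sum -sumrB.
    apply: eq_bigr => e _; rewrite mulr_suml -sumrB.
    by apply: eq_bigr => c _.
  rewrite /star_sum; apply: is_derive_big => e; apply: is_derive_big_in => c ce.
  have [/andP[c0 cl] _] := star_at _ _ _ st _ _ ce.
  have d1 : is_derive s (1 : R) (fun s => P e (c + 1 * s))
      ((c != len e)%:R * on_edges u e (c + s) * 1).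
    apply: is_derive_affine; have [cE|cT] := star_right _ _ _ st _ _ ce.
      by rewrite cE eqxx mul0r; apply: stepint_derive_out; right; rewrite mul1r ltrDl.
    have -> : c != len e by apply/eqP => cE; lra.
    by rewrite !mul1r; apply: stepint_derive => //; [apply/andP; split; lra|exact: uc].
  have d2 : is_derive s (1 : R) (fun s => P e (c + (-1) * s))
      ((c != 0)%:R * on_edges u e (c - s) * (-1)).
    apply: is_derive_affine; have [cE|cT] := star_left _ _ _ st _ _ ce.
      by rewrite cE eqxx mul0r; apply: stepint_derive_out; left; rewrite mulN1r; lra.
    have -> : c != 0 by apply/eqP => cE; lra.
    by rewrite mulN1r !mul1r; apply: stepint_derive => //; [apply/andP; split; lra|exact: uc].
  have d3 := is_derive_lin _ _ 1 (-1) _ _ _ d1 d2.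
  apply: (is_derive_eq d3); rewrite (uq _ _ ce).
  (* In a direction that leaves the edge, [edge_point] is constant, so [u] keeps the value [u q]
     there and drops out of the second difference. Only the directions counted by [degree]
     remain. *)
  have E1 : (c != 0)%:R * on_edges u e (c - s)
      = on_edges u e (c - s) - (1 - (c != 0)%:R) * u q.
    have [cE|cN] := eqVneq c 0; last by rewrite /=; ring.
    rewrite /= -(uq _ _ ce) cE /on_edges !edge_point_le0; [|lra|lra].
    by rewrite mul0r subr0 mul1r subrr.
  have E2 : (c != len e)%:R * on_edges u e (c + s)
      = on_edges u e (c + s) - (1 - (c != len e)%:R) * u q.
    have [cE|cN] := eqVneq c (len e); last by rewrite /=; ring.
    rewrite /= -(uq _ _ ce) cE /on_edges !edge_point_ge; [|lra|lra].
    by rewrite mul0r subr0 mul1r subrr.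
  by rewrite E1 E2; ring.
have [h1 h2] := cosine_ode T k _ Y W Yc Wc Y0 W0 dW dY t tT.
split.
  rewrite -h1; congr (_ ^+ 2); apply: eq_bigr => e _; apply: eq_bigr => c _.
  by rewrite !mul1r !mulN1r.
rewrite -h2; move: tT; rewrite le_eqVlt => /andP[/predU1P[<- _|t0 tT]].
  rewrite W0 mulr0 /star_sum big1// => e _; rewrite big1// => c _.
  by rewrite addr0 subr0; ring.
by apply: weakW; rewrite t0.
Qed.
Lemma inner_sym {R : realType} {G : metricGraph R} (f g : edge_family G) :
  inner f g = inner g f.
Proof.
by apply: eq_bigr => e _; apply: eq_Rintegral => x _; rewrite mulrC.
Qed.

Lemma in_L2_lin {R : realType} {G : metricGraph R} (a b : R)
    (f g : edge_family G) : in_L2 f -> in_L2 g ->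
  in_L2 (fun e x => a * f e x + b * g e x).
Proof. by move=> hf hg e; apply: L2on_lin; [exact: hf|exact: hg]. Qed.

Lemma inner_lin {R : realType} {G : metricGraph R} (a b : R)
    (f g h : edge_family G) : in_L2 f -> in_L2 g -> in_L2 h ->
  inner (fun e x => a * f e x + b * g e x) h = a * inner f h + b * inner g h.
Proof.
move=> hf hg hh; rewrite /inner !mulr_sumr -big_split/=; apply: eq_bigr => e _.
rewrite -(Rintegral_lin _ a b _ _ (L2on_mul _ _ _ (hf e) (hh e))
  (L2on_mul _ _ _ (hg e) (hh e))).
by apply: eq_Rintegral => x _; ring.
Qed.

Lemma inner_ge0 {R : realType} {G : metricGraph R} (f : edge_family G) :
  0 <= inner f f.
Proof.
apply: sumr_ge0 => e _; apply: Rintegral_ge0 => x _.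
by rewrite -expr2 sqr_ge0.
Qed.

Lemma parseval {R : realType} {G : metricGraph R} (psi : nat -> gpoint G -> R)
    (f : gpoint G -> R) : orthonormal_basis psi -> in_L2 (on_edges f) ->
  (fun N => \sum_(j < N) inner (on_edges f) (on_edges (psi j)) ^+ 2) @ \oo
    --> inner (on_edges f) (on_edges f).
Proof.
move=> [psi2 ortho complete] f2; have := complete f f2.
set c := fun j => inner (on_edges f) (on_edges (psi j)).
pose r N : edge_family G := on_edges (fun p => f p - \sum_(j < N) c j * psi j p).
have rS N : r N.+1 = fun e x => 1 * r N e x + (- c N) * on_edges (psi N) e x.
  apply/funext => e; apply/funext => x; rewrite /r /on_edges big_ord_recr/=.
  by ring.
have r0 : r 0%N = on_edges f.
  by apply/funext => e; apply/funext => x; rewrite /r /on_edges big_ord0 subr0.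
have rL2 N : in_L2 (r N).
  by elim: N => [|N IH]; rewrite ?r0// rS; apply: in_L2_lin.
have rpsi N m : (N <= m)%N -> inner (r N) (on_edges (psi m)) = c m.
  elim: N => [_|N IH Nm]; first by rewrite r0.
  rewrite rS inner_lin// IH ?(ltnW Nm)// ortho (ltn_eqF Nm).
  by rewrite mulr0 addr0 mul1r.
have rr N : inner (r N) (r N) =
    inner (on_edges f) (on_edges f) - \sum_(j < N) c j ^+ 2.
  elim: N => [|N IH]; first by rewrite r0 big_ord0 subr0.
  rewrite {1}rS inner_lin// (inner_sym _ (r N.+1)) (inner_sym (on_edges _) (r N.+1)).
  rewrite rS !inner_lin// IH rpsi// ortho eqxx (inner_sym _ (r N)) rpsi//.
  by rewrite big_ord_recr/=; ring.
move=> cv.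
have cv2 : (fun N => inner (r N) (r N)) @ \oo --> (0 : R).
  rewrite (_ : (fun N => _) = fun N => norm2 (r N) * norm2 (r N)).
    by rewrite -[0](mulr0 0); apply: cvgM.
  by apply/funext => N; rewrite -expr2 /norm2 sqr_sqrtr// inner_ge0.
rewrite (_ : (fun N => _) =
    fun N => inner (on_edges f) (on_edges f) - inner (r N) (r N)).
  by rewrite -[X in _ --> X]subr0; apply: cvgB => //; exact: cvg_cst.
by apply/funext => N; rewrite rr opprB addrC subrK.
Qed.

(** The ball has measure [d t] and its squared coefficients are [(d psi_j(q) t) ^ 2 sinc2 (t k_j)];
    Parseval's identity is divided by [d t ^ 2]. The radius is halved because [sampled] includes its
    endpoint, which [star_ball] excludes. *)
Lemma star_sampled {R : realType} {G : metricGraph R}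
    (psi : nat -> gpoint G -> R) (lambda : nat -> R) (q : gpoint G) (T : R)
    (cen : edge G -> seq R) :
  orthonormal_basis psi ->
  (forall j : nat, eigenfunction (lambda j) (psi j)) ->
  (forall j, 0 <= lambda j) -> star q T cen -> (0 < degree q)%N ->
  sampled (T / 2) (fun j => Num.sqrt (lambda j)) (fun j => (degree q)%:R * psi j q ^+ 2).
Proof.
move=> basis eigen lam0 st deg0; have d0 : 0 < (degree q)%:R :> R by rewrite ltr0n.
split=> [j|t tT2]; first by rewrite mulr_ge0 ?sqr_ge0.
have T0 := star_T_gt0 _ _ _ st.
have tTlt : 0 < t < T by move/andP: tT2 => [-> ?]; lra.
have tT : 0 < t <= T by move/andP: tTlt => [-> ?]; lra.
have [f fE] := star_ball _ _ _ st t tTlt; have /andP[t0 tT'] := tT.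
have l0 (e : edge G) := ltW (len_gt0 e).
have fL2 : in_L2 (on_edges f).
  move=> e; have : L2on (len e) (fun x => \sum_(c <- cen e) ball_ind t c x).
    by apply: L2on_big => c; exact: L2on_ball.
  rewrite /L2on (_ : _ \_ _ = on_edges f e \_ `[0, len e])//.
  apply/funext => x; rewrite !patchE; case: ifPn => //.
  by rewrite inE/= in_itv/= => xl; rewrite fE.
have inner_ball g : (forall e, intg (len e) (g e)) ->
    inner (on_edges f) g = star_sum cen (fun e c =>
      stepint (len e) (g e) (c + t) - stepint (len e) (g e) (c - t)).
  move=> gi; apply: eq_bigr => e _.
  transitivity (\int[@lebesgue_measure R]_(x in `[0%R, len e])
     \sum_(c <- cen e) ball_ind t c x * g e x)%R.
    apply: eq_Rintegral => x; rewrite inE/= in_itv/= => xl.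
    by rewrite fE// mulr_suml.
  rewrite Rintegral_big.
    by apply: eq_bigr => c _; exact: int_ball.
  move=> c; have h := intg_lin _ 1 (-1) _ _ (intg_step _ (c + t) _ (gi e))
    (intg_step _ (c - t) _ (gi e)).
  move: h; congr (intg _ _); apply/funext => x; rewrite /ball_ind; ring.
have fsq : inner (on_edges f) (on_edges f) = (degree q)%:R * t.
  transitivity (inner (on_edges f) (fun e x => 1)).
    apply: eq_bigr => e _; apply: eq_Rintegral => x; rewrite inE/= in_itv/= => xl.
    by rewrite fE// mulr1 -expr2 (star_disjoint _ _ _ st).
  rewrite inner_ball; last by move=> e; apply: intg_continuous => x; exact: cvg_cst.
  rewrite (star_degree _ _ _ st) mulr_suml; apply: eq_bigr => e _.
  rewrite mulr_suml [LHS]big_seq [RHS]big_seq; apply: eq_bigr => c ce.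
  rewrite !stepint_cst//; have [/andP[c0 cl] _] := star_at _ _ _ st _ _ ce.
  have -> : clamp (len e) (c + t) = c + (c != len e)%:R * t.
    rewrite /clamp max_r ?addr_ge0 ?(ltW t0)//.
    have [->|cT] := star_right _ _ _ st _ _ ce.
      by rewrite eqxx mul0r addr0 min_l// lerDl ltW.
    by rewrite (_ : c != len e) ?mul1r ?min_r//; [lra|apply/eqP => cE; lra].
  have -> : clamp (len e) (c - t) = c - (c != 0)%:R * t.
    rewrite /clamp; have [cE|cT] := star_left _ _ _ st _ _ ce.
      by rewrite cE eqxx mul0r subr0 max_l ?min_r//; lra.
    rewrite (_ : c != 0) ?mul1r; last by apply/eqP => cE; lra.
    by rewrite max_r ?min_r//; lra.
  by ring.
have := parseval psi f basis fL2; rewrite fsq => cv.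
have E j : inner (on_edges f) (on_edges (psi j)) ^+ 2 =
    ((degree q)%:R * t ^+ 2) *
      ((degree q)%:R * psi j q ^+ 2 * sinc2 (t * Num.sqrt (lambda j))).
  have [_ [_ [du Hu weak]]] := eigen j.
  rewrite inner_ball; last first.
    by move=> e; apply: intg_continuous; exact: H1_deriv_continuous Hu.
  rewrite -(sqr_sqrtr (lam0 j)) in weak.
  have tT0 : 0 <= t <= T by rewrite ltW.
  by rewrite (star_eigen _ _ _ _ _ _ _ st Hu weak tT0).1; ring.
have c0 : (degree q)%:R * t ^+ 2 != 0 by rewrite mulf_neq0 ?expf_neq0 ?gt_eqF.
rewrite (_ : (fun N => _) = fun N => ((degree q)%:R * t ^+ 2)^-1 *
   \sum_(j < N) inner (on_edges f) (on_edges (psi j)) ^+ 2); last first.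
  apply/funext => N; rewrite mulr_sumr; apply: eq_bigr => j _.
  by rewrite E mulKf.
have -> : t^-1 = ((degree q)%:R * t ^+ 2)^-1 * ((degree q)%:R * t).
  by field; rewrite !gt_eqF.
exact: cvgMr.
Qed.

(** * Existence of stars *)

Lemma ball_ind_sqr {R : realType} (t c x : R) : 0 <= t ->
  ball_ind t c x ^+ 2 = ball_ind t c x.
Proof.
move=> t0; rewrite /ball_ind /step.
have [h1|h1] := leP x (c + t); have [h2|h2] := leP x (c - t) => /=; try ring.
by exfalso; lra.
Qed.

Lemma ball_ind0 {R : realType} (t c x : R) : 0 <= t ->
  x <= c - t \/ c + t < x -> ball_ind t c x = 0.
Proof.
move=> t0 H; rewrite /ball_ind /step; case: H => H.
  by rewrite H (_ : x <= c + t) ?subrr//; lra.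
by rewrite leNgt H leNgt (_ : c - t < x) ?subrr//; lra.
Qed.

Lemma ball_ind1 {R : realType} (t c x : R) :
  c - t < x <= c + t -> ball_ind t c x = 1.
Proof. by move=> /andP[h1 h2]; rewrite /ball_ind /step h2 leNgt h1 subr0. Qed.

Lemma tent0 {R : realType} (t c x : R) : 0 <= t ->
  x <= c - t \/ c + t <= x -> tent t c x = 0.
Proof.
move=> t0 H; rewrite /tent /ramp.
by case: H => H; [rewrite !max_r|rewrite !max_l]; lra.
Qed.

Lemma tent_center {R : realType} (t c : R) : 0 <= t -> tent t c c = t.
Proof.
move=> t0; rewrite /tent /ramp (@max_r _ _ _ (c + t - c)); last lra.
by rewrite max_l ?max_l; lra.
Qed.

Lemma star_interior {R : realType} {G : metricGraph R} (e : edge G)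
    (x : {x : R | 0 < x < len e}) :
  star (@Interior R G e x) (Num.min (val x) (len e - val x))
    (fun e' => if e' == e then [:: val x] else [::]).
Proof.
have /andP[x0 xl] := valP x; set T := Num.min _ _.
have Tx : T <= val x by rewrite /T ge_min lexx.
have Tl : T <= len e - val x by rewrite /T ge_min lexx orbT.
have T0 : 0 < T by rewrite /T lt_min x0 subr_gt0.
have sing (F : R -> R) (e' : edge G) :
    \sum_(c <- (if e' == e then [:: val x] else [::])) F c
      = if e' == e then F (val x) else 0.
  by case: eqP => _; rewrite ?big_seq1 ?big_nil.
split.
- exact: T0.
- move=> e' c; case: eqP => // -> ; rewrite inE => /eqP ->.
  by rewrite !ltW//; split => //; exact: edge_point_val.
- by move=> e' c; case: eqP => // _; rewrite inE => /eqP ->; right.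
- by move=> e' c; case: eqP => // -> ; rewrite inE => /eqP ->; right; lra.
- move=> e' t y /andP[t0 _]; rewrite !sing; case: eqP => _.
    by rewrite ball_ind_sqr// ltW.
  by rewrite expr0n.
- move=> t /andP[t0 tT]; apply: (glue_edges _ (fun=> 0)) => e'.
  rewrite !sing; case: eqP => // ->; split; apply: (tent0 _ _ _ (ltW t0)).
    by left; lra.
  by right; lra.
- move=> t /andP[t0 tT]; apply: (glue_edges _ (fun=> 0)) => e'.
  rewrite !sing; case: eqP => // ->; split; apply: (ball_ind0 _ _ _ (ltW t0)).
    by left; lra.
  by right; lra.
- rewrite /degree (bigD1 e)//= eqxx big_seq1 big1 ?addr0; last first.
    by move=> i /negbTE ->; rewrite big_nil.
  by rewrite gt_eqF// lt_eqF.
Qed.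

Lemma len_lower_bound {R : realType} (G : metricGraph R) :
  exists m : R, 0 < m /\ forall e : edge G, m <= len e.
Proof.
(* The sum of the inverses bounds each of them and stands in for a minimum; the 1 keeps it positive
   on a graph without edges. *)
pose s := 1 + \sum_(e : edge G) (len e)^-1.
have s0 (e : edge G) : (len e)^-1 <= s.
  rewrite /s (bigD1 e)//= addrCA lerDl addr_ge0// sumr_ge0// => i _.
  by rewrite invr_ge0 ltW// len_gt0.
have sp : 0 < s.
  by rewrite /s ltr_pwDl// sumr_ge0// => i _; rewrite invr_ge0 ltW// len_gt0.
exists s^-1; split; first by rewrite invr_gt0.
move=> e; rewrite -[leRHS]invrK lef_pV2 ?posrE ?invr_gt0 ?len_gt0//.
Qed.

Lemma star_vertex {R : realType} {G : metricGraph R} (v : vertex G) :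
  exists T cen, star (@Vertex R G v) T cen.
Proof.
have [m [m0 ml]] := len_lower_bound G.
(* Half of a lower bound for the lengths keeps the balls about the two ends of a loop disjoint. *)
pose T := m / 2.
(* A loop at [v] lists both of its ends and so counts twice, as in the degree. *)
pose cen (e : edge G) := (if src e == v then [:: 0] else [::]) ++
                         (if tgt e == v then [:: len e] else [::]).
exists T, cen; have T0 : 0 < T by rewrite divr_gt0.
have lT (e : edge G) : 2 * T <= len e by rewrite /T; have := ml e; lra.
have lp (e : edge G) : 0 < len e := len_gt0 e.
have cenE e c : c \in cen e -> (c = 0 /\ src e = v) \/ (c = len e /\ tgt e = v).
  rewrite /cen mem_cat => /orP[]; case: eqP => // h; rewrite inE => /eqP ->.
    by left.
  by right.
have sumE (F : R -> R) (e : edge G) : \sum_(c <- cen e) F c =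
    (src e == v)%:R * F 0 + (tgt e == v)%:R * F (len e).
  rewrite /cen big_cat/=; congr (_ + _); case: eqP => _;
    by rewrite ?big_seq1 ?big_nil ?mul1r ?mul0r.
split.
- exact: T0.
- move=> e c /cenE [[-> h]|[-> h]]; split; rewrite ?lexx ?ltW//.
    by rewrite edge_point_le0// h.
  by rewrite edge_point_ge// h.
- move=> e c /cenE [[-> h]|[-> h]]; [by left|right].
  by have := lT e; lra.
- move=> e c /cenE [[-> h]|[-> h]]; [right|by left].
  by have := lT e; lra.
- move=> e t x /andP[t0 tT]; rewrite sumE.
  have h1 := ball_ind_sqr t 0 x (ltW t0).
  have h2 := ball_ind_sqr t (len e) x (ltW t0).
  have h3 : ball_ind t 0 x * ball_ind t (len e) x = 0.
    have [xt|xt] := leP x (len e - t).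
      by rewrite (ball_ind0 t (len e)) ?mulr0//; [exact: ltW|left].
    by rewrite (ball_ind0 t 0) ?mul0r//; [exact: ltW|right; have := lT e; lra].
  move: h1 h2 h3; set a := ball_ind t 0 x; set b := ball_ind t (len e) x.
  move=> h1 h2 h3; case: (src e == v); case: (tgt e == v) => /=.
  + by rewrite !mul1r sqrrD h1 h2 h3 mul0rn addr0.
  + by rewrite mul1r mul0r addr0.
  + by rewrite mul1r mul0r add0r.
  + by rewrite !mul0r addr0 expr0n.
- move=> t /andP[t0 tT]; apply: (glue_edges _ (fun w => (w == v)%:R * t)) => e.
  have := lT e; have t0' := ltW t0.
  rewrite !sumE !tent_center// => h; split.
    by rewrite (tent0 t (len e)) ?mulr0 ?addr0//; left; lra.
  by rewrite (tent0 t 0) ?mulr0 ?add0r//; right; lra.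
- move=> t /andP[t0 tT]; apply: (glue_edges _ (fun w => (w == v)%:R)) => e.
  have := lT e; have t0' := ltW t0.
  rewrite !sumE => h; split.
    rewrite (ball_ind0 t (len e)) ?mulr0 ?addr0//; last by left; lra.
    by rewrite ball_ind1 ?mulr1//; apply/andP; split; lra.
  rewrite (ball_ind0 t 0) ?mulr0 ?add0r//; last by right; lra.
  by rewrite ball_ind1 ?mulr1//; apply/andP; split; lra.
- rewrite /degree /vertex_degree natrD !cardsE -!sum1_card !natr_sum.
  under [X in _ = X]eq_bigr => e _ do
    rewrite sumE !eqxx (gt_eqF (lp e)) (lt_eqF (lp e))/= add0r addr0 !mulr1.
  rewrite big_split/=; congr (_ + _); rewrite big_mkcond/=; apply: eq_bigr => e _.
    by rewrite -[_ \in _]/(src e == v); case: (src e == v).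
  by rewrite -[_ \in _]/(tgt e == v); case: (tgt e == v).
Qed.
Lemma sampled_shrink {R : realType} (T T' : R) (k a : nat -> R) :
  T' <= T -> sampled T k a -> sampled T' k a.
Proof.
move=> TT [a0 ha]; split=> // t /andP[t0 tT]; apply: ha; rewrite t0.
exact: le_trans tT TT.
Qed.

Lemma integral_bound_ends {R : realType} (l r A B : R) (g : R -> R) :
  0 <= l -> 0 <= r -> 0 <= A -> 0 <= B -> continuous g ->
  (forall x, 0 <= x <= l -> `|g x| <= B) ->
  (forall x, r < x <= l - r -> `|g x| <= A) ->
  `|(\int[@lebesgue_measure R]_(x in `[0%R, l]) g x)%R| <= A * l + 2 * r * B.
Proof.
move=> l0 r0 A0 B0 gc gB gA; have ig := intg_continuous l g gc.
have i1 : intg l (fun=> 1) by apply: intg_continuous => x; exact: cvg_cst.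
have is1 a : intg l (fun x => step a x * 1) by exact: intg_step.
(* [h] is [A] on the middle part and [A + B] on the two end strips. It still dominates when
   [l < 2 r]: the strips then overlap, and [h] is [A + 2 B] on the overlap. *)
pose h x := (A + B) * 1 + B * (1 * (step r x * 1) + (-1) * (step (l - r) x * 1)).
have ih : intg l h by apply: intg_lin => //; exact: intg_lin.
apply: le_trans (le_normr_Rintegral _ ig) _ => //.
apply: le_trans (_ : (\int[@lebesgue_measure R]_(x in `[0%R, l]) h x)%R <= _).
  apply: le_Rintegral => //; first exact: integrable_norm.
  move=> x; rewrite /= in_itv/= => xl; rewrite /h /step.
  have h1 := gB x xl; have h2 := gA x.
  have [xr|rx] := leP x r; have [xlr|lrx] := leP x (l - r) => /=; lra.
have il : (\int[@lebesgue_measure R]_(x in `[0%R, l]) 1)%R = l.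
  rewrite -(stepint_gt l l)// stepint_cst// /clamp min_l//.
  by rewrite le_max lexx orbT.
rewrite /h Rintegral_lin//; last exact: intg_lin.
rewrite Rintegral_lin// -/(stepint l (fun=> 1) r) -/(stepint l (fun=> 1) (l - r)).
rewrite il !stepint_cst//.
have h1 : clamp l r <= r by rewrite /clamp (max_r r0) ge_min lexx orbT.
have h2 : l - r <= clamp l (l - r) by rewrite /clamp le_min le_max lexx orbT andbT; lra.
have : B * (clamp l r - clamp l (l - r)) <= B * (r - (l - r)).
  by rewrite ler_wpM2l// lerB.
lra.
Qed.

Lemma vertex_degree_gt0 {R : realType} {G : metricGraph R} (v : vertex G)
    (e : edge G) : connected_graph G -> (0 < vertex_degree v)%N.
Proof.
move=> conn; have pos (e' : edge G) : (src e' == v) || (tgt e' == v) ->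
    (0 < vertex_degree v)%N.
  rewrite /vertex_degree addn_gt0 => /orP[h|h]; apply/orP; [left|right];
    by apply/card_gt0P; exists e'; rewrite inE.
have /connectP [[_ /= E|w p /= /andP[+ _] _]] := conn v (src e).
  by apply: (pos e); rewrite E eqxx.
by move=> /existsP[e' /orP[/andP[h _]|/andP[_ h]]]; apply: (pos e'); rewrite h ?orbT.
Qed.

Lemma eigen_cosine_addition {R : realType} {G : metricGraph R} (u : gpoint G -> R)
    (lam : R) (e : edge G) (y s : R) : 0 <= lam -> eigenfunction lam u ->
  0 < y < len e -> 0 <= s -> s <= y -> s <= len e - y ->
  on_edges u e (y - s) + on_edges u e (y + s)
    = 2 * cos (s * Num.sqrt lam) * on_edges u e y.
Proof.
move=> lam0 [_ [_ [du Hu weak]]] yl s0 sy sl.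
have st := star_interior e (exist _ y yl).
rewrite -(sqr_sqrtr lam0) in weak.
have sT : 0 <= s <= Num.min y (len e - y) by rewrite s0 le_min sy sl.
have [_] := star_eigen _ _ _ _ _ _ s st Hu weak sT.
rewrite /star_sum (bigD1 e)//= eqxx big_seq1 big1 ?addr0; last first.
  by move=> i /negbTE ->; rewrite big_nil.
have -> : u (@Interior R G e (exist _ y yl)) = on_edges u e y.
  by rewrite /on_edges -(edge_point_val e (exist _ y yl)).
by move=> h; lra.
Qed.

(** The radius of an interior star shrinks to 0 at the vertices. The addition formula for the cosine
    replaces a point near an end by two points further inside, with constants that do not depend on
    the eigenvalue; [s] has either sign, to step inward from either end. *)
Lemma eigen_reflect_le {R : realType} {G : metricGraph R} (u : gpoint G -> R)
    (lam : R) (e : edge G) (x s : R) : 0 <= lam -> eigenfunction lam u ->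
  0 <= x <= len e -> 0 < x + s < len e -> 0 <= x + s + s <= len e ->
  on_edges u e x ^+ 2
    <= 8 * on_edges u e (x + s) ^+ 2 + 2 * on_edges u e (x + s + s) ^+ 2.
Proof.
move=> lam0 eig /andP[x0 xl] ysl /andP[z0 zl].
have [b] : exists b, on_edges u e x + on_edges u e (x + s + s)
    = 2 * cos b * on_edges u e (x + s).
  have /andP[y0 yl] := ysl.
  have [s0|s0] := leP 0 s.
    exists (s * Num.sqrt lam); rewrite -eigen_cosine_addition//; [|lra|lra].
    by rewrite addrK.
  exists (- s * Num.sqrt lam); rewrite -eigen_cosine_addition//; [|lra|lra|lra].
  by rewrite addrC opprK addrK.
set a := on_edges u e x; set c := on_edges u e (x + s + s).
set d := on_edges u e (x + s) => h.
have -> : a = 2 * cos b * d - c by rewrite -h addrK.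
have cb : cos b ^+ 2 <= 1.
  by rewrite -(real_normK (num_real (cos b))) expr_le1// cos_max.
have h2 : cos b ^+ 2 * d ^+ 2 <= d ^+ 2 by rewrite ler_piMl// sqr_ge0.
have h3 : 0 <= (2 * cos b * d + c) ^+ 2 by exact: sqr_ge0.
have E : (2 * cos b * d - c) ^+ 2 = 8 * (cos b ^+ 2 * d ^+ 2) + 2 * c ^+ 2
   - (2 * cos b * d + c) ^+ 2 by ring.
by rewrite E; lra.
Qed.

(** * Local Weyl law *)

Lemma interior_sampled {R : realType} {G : metricGraph R}
    (psi : nat -> gpoint G -> R) (lambda : nat -> R) (e : edge G) (x r : R) :
  orthonormal_basis psi ->
  (forall j : nat, eigenfunction (lambda j) (psi j)) ->
  (forall j, 0 <= lambda j) -> 0 < r -> r <= x <= len e - r ->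
  sampled (r / 2) (fun j => Num.sqrt (lambda j))
    (fun j => 2 * on_edges (psi j) e x ^+ 2).
Proof.
move=> basis eigen lam0 r0 /andP[rx xr].
have xl : 0 < x < len e by apply/andP; split; lra.
have st := star_interior e (exist _ x xl).
have := star_sampled _ _ _ _ _ basis eigen lam0 st isT.
rewrite /degree -(edge_point_val e (exist _ x xl)) /= => h.
by apply: sampled_shrink h; rewrite ler_pM2r// le_min rx; lra.
Qed.

(** In the middle half of the edge stars have radius at least [len e / 4], whence the bound [2 K].
    Elsewhere one or two steps of length [len e / 4] both land in the middle half, and
    [8 * 2 K + 2 * 2 K = 20 K]. *)
Lemma edge_sum_le {R : realType} {G : metricGraph R}
    (psi : nat -> gpoint G -> R) (lambda : nat -> R) (e : edge G) (K x : R)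
    (N : nat) :
  orthonormal_basis psi ->
  (forall j : nat, eigenfunction (lambda j) (psi j)) ->
  (forall j, 0 <= lambda j) -> 8 / len e <= K ->
  (forall j, (j < N)%N -> Num.sqrt (lambda j) <= K) -> 0 <= x <= len e ->
  \sum_(j < N) on_edges (psi j) e x ^+ 2 <= 20 * K.
Proof.
move=> basis eigen lam0 KT lK xl; have l0 := len_gt0 e.
have K0 : 0 < K by apply: lt_le_trans KT; rewrite divr_gt0.
have mid y : len e / 4 <= y <= len e - len e / 4 ->
    \sum_(j < N) on_edges (psi j) e y ^+ 2 <= 2 * K.
  move=> yl; have l4 : 0 < len e / 4 by rewrite divr_gt0.
  have h := interior_sampled _ _ _ _ _ basis eigen lam0 l4 yl.
  have T0 : 0 < len e / 4 / 2 by rewrite divr_gt0.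
  have TK : (len e / 4 / 2)^-1 <= K.
    by apply: le_trans KT; rewrite le_eqVlt; apply/orP; left; apply/eqP; field;
      rewrite gt_eqF.
  have := sampled_sum_le _ _ _ _ N T0 TK h; rewrite -mulr_sumr => H.
  have : 2 * \sum_(j < N) on_edges (psi j) e y ^+ 2 <= 4 * K.
    by apply: H => j jN; rewrite sqrtr_ge0 lK.
  lra.
have refl s : 0 < x + s < len e -> 0 <= x + s + s <= len e ->
    len e / 4 <= x + s <= len e - len e / 4 ->
    len e / 4 <= x + s + s <= len e - len e / 4 ->
    \sum_(j < N) on_edges (psi j) e x ^+ 2 <= 20 * K.
  move=> h1 h2 h3 h4.
  apply: le_trans (_ : 8 * (2 * K) + 2 * (2 * K) <= _); last by lra.
  apply: le_trans (lerD (ler_wpM2l _ (mid _ h3)) (ler_wpM2l _ (mid _ h4))) => //.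
  rewrite !mulr_sumr -big_split/=; apply: ler_sum => j _.
  exact: eigen_reflect_le (lam0 j) (eigen j) xl h1 h2.
have /andP[x0 x1] := xl.
have [xa|xa] := ltP x (len e / 4); first by apply: (refl (len e / 4)); lra.
have [xb|xb] := ltP (len e - len e / 4) x; first by apply: (refl (- (len e / 4))); lra.
by apply: le_trans (mid _ _) _; [rewrite xa|lra].
Qed.

Lemma sum_edge_integral {R : realType} {G : metricGraph R}
    (psi : nat -> gpoint G -> R) (lambda : nat -> R) (N : nat) :
  orthonormal_basis psi ->
  (forall j : nat, eigenfunction (lambda j) (psi j)) ->
  \sum_(e : edge G) (\int[@lebesgue_measure R]_(x in `[0%R, len e])
    \sum_(j < N) on_edges (psi j) e x ^+ 2)%R = N%:R.
Proof.
move=> [psi2 ortho _] eigen.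
under eq_bigr => e _.
  rewrite Rintegral_big; last first.
    by move=> j; have := L2on_mul _ _ _ (psi2 j e) (psi2 j e).
  over.
rewrite exchange_big/= -[N in RHS]card_ord -sum1_card natr_sum.
by apply: eq_bigr => j _; have := ortho j j; rewrite eqxx.
Qed.

Lemma eigenfunction_continuous {R : realType} {G : metricGraph R} (lam : R)
    (u : gpoint G -> R) (e : edge G) :
  eigenfunction lam u -> continuous (on_edges u e).
Proof. by move=> [_ [_ [du Hu _]]]; exact: H1_deriv_continuous Hu. Qed.
(** Since each [psi_j ^ 2] has integral 1, integrating the uniform bound over the graph counts the
    eigenvalues. This is how [k_N] is seen to tend to infinity. *)
Lemma count_le {R : realType} {G : metricGraph R}
    (psi : nat -> gpoint G -> R) (lambda : nat -> R) (K : R) (N : nat) :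
  orthonormal_basis psi ->
  (forall j : nat, eigenfunction (lambda j) (psi j)) ->
  (forall j, 0 <= lambda j) -> 0 <= K -> (forall e : edge G, 8 / len e <= K) ->
  (forall j, (j < N)%N -> Num.sqrt (lambda j) <= K) ->
  N%:R <= 20 * K * total_length G.
Proof.
move=> basis eigen lam0 K0 KT lK.
rewrite -(sum_edge_integral _ _ N basis eigen) /total_length mulr_sumr.
apply: ler_sum => e _; apply: le_trans (ler_norm _) _.
have b x : 0 <= x <= len e ->
    `|\sum_(j < N) on_edges (psi j) e x ^+ 2| <= 20 * K.
  move=> xl; rewrite ger0_norm; last by apply: sumr_ge0 => j _; exact: sqr_ge0.
  exact: edge_sum_le basis eigen lam0 (KT e) lK xl.
have K20 : 0 <= 20 * K by rewrite mulr_ge0.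
have l0 := ltW (len_gt0 e).
have h : 20 * K * len e = 20 * K * len e + 2 * 0 * (20 * K) by ring.
rewrite h; apply: integral_bound_ends => //.
  apply: continuous_big => j x.
  by apply: cvgM; exact: eigenfunction_continuous (eigen j) x.
by move=> x /andP[x0 xl]; apply: b; rewrite (ltW x0) -[len e]subr0.
Qed.

Lemma eigenvalue_unbounded {R : realType} {G : metricGraph R}
    (psi : nat -> gpoint G -> R) (lambda : nat -> R) (B : R) :
  orthonormal_basis psi ->
  (forall j : nat, eigenfunction (lambda j) (psi j)) ->
  (forall j, 0 <= lambda j) ->
  {homo (fun j => Num.sqrt (lambda j)) : i j / (i <= j)%N >-> i <= j} ->
  exists N0, forall N, (N0 <= N)%N -> B <= Num.sqrt (lambda N).
Proof.
move=> basis eigen lam0 mono; have [m [m0 ml]] := len_lower_bound G.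
pose K := Num.max B (8 / m).
have K0 : 0 <= K by rewrite le_max divr_ge0 ?orbT// ltW.
have KT (e : edge G) : 8 / len e <= K.
  rewrite le_max; apply/orP; right; rewrite ler_pM2l//.
  by rewrite lef_pV2 ?posrE ?len_gt0.
pose N0 := (Num.truncn (20 * K * total_length G)).+1.
exists N0 => N NN; rewrite leNgt; apply/negP => kB.
have : N.+1%:R <= 20 * K * total_length G.
  apply: (count_le _ _ _ _ basis eigen lam0 K0 KT) => j jN.
  apply: le_trans (mono _ _ _) _; first exact: jN.
  by rewrite le_max (ltW kB).
apply/negP; rewrite -ltNge.
apply: lt_trans (truncnS_gt _) _; rewrite ltr_nat ltnS; exact: NN.
Qed.

Lemma weyl_close {R : realType} {G : metricGraph R}
    (psi : nat -> gpoint G -> R) (lambda : nat -> R) (q : gpoint G)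
    (T eps : R) (cen : edge G -> seq R) :
  orthonormal_basis psi ->
  (forall j : nat, eigenfunction (lambda j) (psi j)) ->
  (forall j, 0 <= lambda j) ->
  {homo (fun j => Num.sqrt (lambda j)) : i j / (i <= j)%N >-> i <= j} ->
  star q T cen -> (0 < degree q)%N -> 0 < eps ->
  exists N0, forall N, (N0 <= N)%N ->
    `|(degree q)%:R * total_length G * \sum_(j < N) psi j q ^+ 2 - 2 * N%:R|
      <= eps * Num.sqrt (lambda N).
Proof.
move=> basis eigen lam0 mono st deg0 eps0.
pose k j := Num.sqrt (lambda j).
have k0 j : 0 <= k j by exact: sqrtr_ge0.
have L0 : 0 <= total_length G by apply: sumr_ge0 => e _; rewrite ltW// len_gt0.
(* Half of [eps] goes to the middle parts, of total length at most [L], and half to the strips of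
   width [r] at the two ends of each edge, where the integrand is at most [40 k N]. Each added 1
   keeps a denominator positive. *)
pose d := eps / (2 * (total_length G + 1)).
have d0 : 0 < d by rewrite divr_gt0// mulr_gt0// ltr_wpDl.
pose r := eps / (160 * (#|edge G|%:R + 1)).
have r0 : 0 < r by rewrite divr_gt0// mulr_gt0// ltr_wpDl.
have dE : d * (2 * (total_length G + 1)) = eps.
  by rewrite /d divfK// gt_eqF// mulr_gt0// ltr_wpDl.
have rE : r * (160 * (#|edge G|%:R + 1)) = eps.
  by rewrite /r divfK// gt_eqF// mulr_gt0// ltr_wpDl.
have [C [C0 close]] := sampled_sum_close d d0.
have [m [m0 ml]] := len_lower_bound G.
have T0 := star_T_gt0 _ _ _ st.
(* One sampling radius for [q] and for all points outside the strips, so that a single [N0] serves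
   all of them. *)
pose T' := Num.min (T / 2) (r / 2).
have T'0 : 0 < T' by rewrite lt_min !divr_gt0.
have T'V : 0 < T'^-1 by rewrite invr_gt0.
have qs : sampled T' k (fun j => (degree q)%:R * psi j q ^+ 2).
  apply: sampled_shrink (star_sampled _ _ _ _ _ basis eigen lam0 st deg0).
  by rewrite ge_min lexx.
have xs e x : r <= x <= len e - r ->
    sampled T' k (fun j => 2 * on_edges (psi j) e x ^+ 2).
  move=> xl; apply: sampled_shrink
    (interior_sampled _ _ _ _ _ basis eigen lam0 r0 xl).
  by rewrite ge_min lexx orbT.
have [N0 hN0] := eigenvalue_unbounded psi lambda (C / T' + T'^-1 + 8 / m)
  basis eigen lam0 mono.
exists N0 => N /hN0; rewrite -/(k N) => kN.
have C'0 : 0 < C / T' by rewrite divr_gt0.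
have m8 : 0 < 8 / m by rewrite divr_gt0.
have kC : C / T' <= k N by lra.
have kT : T'^-1 <= k N by lra.
have km (e : edge G) : 8 / len e <= k N.
  apply: le_trans (_ : 8 / m <= _); last by lra.
  by rewrite ler_pM2l// lef_pV2 ?posrE ?len_gt0.
have kN0 : 0 < k N by lra.
have kj j : (j < N)%N -> k j <= k N by move=> jN; apply: mono; exact: ltnW.
set S := \sum_(j < N) psi j q ^+ 2.
have S0 : 0 <= S by apply: sumr_ge0 => j _; exact: sqr_ge0.
have dS : (degree q)%:R * S = \sum_(j < N) (degree q)%:R * psi j q ^+ 2.
  by rewrite mulr_sumr.
have dS4 : (degree q)%:R * S <= 4 * k N.
  rewrite dS; apply: (sampled_sum_le _ _ _ _ N T'0 kT qs) => j jN.
  by rewrite k0 kj.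
pose g (e : edge G) x := (degree q)%:R * S - 2 * \sum_(j < N) on_edges (psi j) e x ^+ 2.
have sumc (e : edge G) : continuous (fun x => \sum_(j < N) on_edges (psi j) e x ^+ 2).
  apply: continuous_big => j x.
  by apply: cvgM; exact: eigenfunction_continuous (eigen j) x.
have gc (e : edge G) : continuous (g e).
  by move=> x; apply: cvgB; [exact: cvg_cst|apply: cvgMr; exact: sumc].
have gB e x : 0 <= x <= len e -> `|g e x| <= 40 * k N.
  move=> xl; rewrite /g; set Sx := \sum_(j < N) _.
  have h1 : Sx <= 20 * k N by exact: edge_sum_le basis eigen lam0 (km e) kj xl.
  have h2 : 0 <= Sx by apply: sumr_ge0 => j _; exact: sqr_ge0.
  have h3 : 0 <= (degree q)%:R * S by rewrite mulr_ge0.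
  by rewrite ler_norml; apply/andP; split; lra.
have gA e x : r < x <= len e - r -> `|g e x| <= d * k N.
  move=> /andP[rx xr]; have xl : r <= x <= len e - r by rewrite ltW.
  have h1 := close _ _ _ _ T'0 qs (xs _ _ xl) k0 mono N kC.
  have h2 := close _ _ _ _ T'0 (xs _ _ xl) qs k0 mono N kC.
  rewrite -!mulr_sumr -/S in h1 h2.
  by rewrite /g ler_norml; apply/andP; split; lra.
clearbody S; have E : (degree q)%:R * total_length G * S - 2 * N%:R =
    \sum_(e : edge G) (\int[@lebesgue_measure R]_(x in `[0%R, len e]) g e x)%R.
  rewrite -(sum_edge_integral _ _ N basis eigen) [X in _ - X]mulr_sumr mulrAC.
  rewrite /total_length [X in X - _]mulr_sumr -sumrB; apply: eq_bigr => e _.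
  have i1 : intg (len e) (fun=> 1) by apply: intg_continuous => x; exact: cvg_cst.
  have iS := intg_continuous (len e) _ (sumc e).
  have := Rintegral_lin _ ((degree q)%:R * S) (-2) _ _ i1 iS.
  have il : (\int[@lebesgue_measure R]_(x in `[0%R, len e]) 1)%R = len e.
    have l0 := ltW (len_gt0 e).
    rewrite -(stepint_gt (len e) (len e))// stepint_cst// /clamp min_l//.
    by rewrite le_max lexx orbT.
  rewrite il -mulNr => <-; apply: eq_Rintegral => x _; rewrite /g; ring.
rewrite E; apply: le_trans (ler_norm_sum _ _ _) _.
apply: le_trans (_ : \sum_(e : edge G) (d * k N * len e + 2 * r * (40 * k N)) <= _).
  apply: ler_sum => e _; apply: integral_bound_ends => //.
  - exact: ltW (len_gt0 e).
  - exact: ltW.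
  - by rewrite mulr_ge0// ltW.
  - by rewrite mulr_ge0// ltW.
  - exact: gB.
  - exact: gA.
rewrite big_split/= -mulr_sumr -/(total_length G) sumr_const.
rewrite (@eq_card _ _ (edge G))// -[X in _ + X]mulr_natr.
clearbody d r; move: dE rE L0; set L := total_length G; set E' : R := #|edge G|%:R.
move=> dE rE L0.
have h1 : d * L <= eps / 2 by lra.
have h2 : 80 * (r * E') <= eps / 2 by lra.
rewrite (_ : d * k N * L + 2 * r * (40 * k N) * E' =
  (d * L + 80 * (r * E')) * k N); last by ring.
by rewrite ler_pM2r//; lra.
Qed.

Lemma star_exists {R : realType} {G : metricGraph R} (q : gpoint G) :
  exists T cen, star q T cen.
Proof.
case: q => [v|e x]; first exact: star_vertex.
by do 2!eexists; exact: star_interior.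
Qed.

(* The indices are shifted by one: psi j and lambda j, for j >= 0, are the
   eigenfunction and the eigenvalue of index j + 1. *)
Theorem theorem4p1 (R : realType) (G : metricGraph R)
    (psi : nat -> gpoint G -> R) (lambda : nat -> R)
    (G_connected : connected_graph G)
    (psi_basis : orthonormal_basis psi)
    (psi_eigen : forall j : nat, eigenfunction (lambda j) (psi j))
    (lambda0 : lambda 0%N = 0)
    (lambda1 : 0 < lambda 1%N)
    (lambda_homo : forall j : nat, lambda j <= lambda j.+1)
    (q : gpoint G) :
  (fun N : nat => (N%:R)^-1 * \sum_(j < N) psi j q ^+ 2)
    @ \oo --> (2 / ((degree q)%:R * total_length G) : R).
Proof.
have lam_mono : {homo lambda : i j / (i <= j)%N >-> i <= j}.
  exact: homo_leq (@lexx _ _) (@le_trans _ _) lambda_homo.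
have lam0 j : 0 <= lambda j by rewrite -lambda0 lam_mono.
have mono : {homo (fun j => Num.sqrt (lambda j)) : i j / (i <= j)%N >-> i <= j}.
  by move=> i j ij; apply: ler_wsqrtr; exact: lam_mono.
(* Without edges every inner product would be an empty sum, and [psi 0] could not have norm 1. *)
have [e0 _] : exists e : edge G, true.
  have [_ ortho _] := psi_basis; case: (pickP (@predT (edge G))) => [e _|none].
    by exists e.
  have := ortho 0%N 0%N; rewrite /inner big_pred0// => /esym /eqP.
  by rewrite oner_eq0.
have deg0 : (0 < degree q)%N.
  by case: q => [v|//]; exact: vertex_degree_gt0 e0 G_connected.
have d0 : 0 < (degree q)%:R :> R by rewrite ltr0n.
have L0 : 0 < total_length G.
  rewrite /total_length (bigD1 e0)//= ltr_pwDl ?len_gt0//.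
  by apply: sumr_ge0 => e _; rewrite ltW// len_gt0.
have [T [cen st]] := star_exists q.
have T0 := star_T_gt0 _ _ _ st.
have smp := star_sampled _ _ _ _ _ psi_basis psi_eigen lam0 st deg0.
set d : R := (degree q)%:R in d0 smp *; set L := total_length G in L0 *.
apply/cvgrPdist_le => eps eps0.
(* A first use to bound [k]: together with [k / 64 <= d * S] it gives
   [L * k / 64 <= 2 * n + L * k / 128], hence [L * k <= 256 * n]. *)
have [N1 h1] := weyl_close _ _ _ _ (L / 128) _ psi_basis psi_eigen lam0 mono st deg0
  (divr_gt0 L0 (ltr0n _ 128)).
(* A second use with this tolerance: by [L * k <= 256 * n] the error is at most [eps * d * L * n],
   and division by [d * L * n] leaves [eps]. *)
have eps1 : 0 < eps * d * L ^+ 2 / 256 by rewrite divr_gt0// !mulr_gt0// exprn_gt0.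
have [N2 h2] := weyl_close _ _ _ _ _ _ psi_basis psi_eigen lam0 mono st deg0 eps1.
have [N3 h3] := eigenvalue_unbounded _ _ (32 / (T / 2)) psi_basis psi_eigen lam0 mono.
exists (maxn (maxn N1 N2) (maxn N3 1)) => // N /=.
rewrite !geq_max => /andP[/andP[/h1 + /h2 +] /andP[/h3 kT N0]].
rewrite -/d -/L; set S := \sum_(j < N) _ ^+ 2; set k := Num.sqrt _.
move=> hN1 hN2; have n0 : 0 < N%:R :> R by rewrite ltr0n.
have dS : k / 64 <= d * S.
  rewrite /S mulr_sumr; apply: sampled_sum_ge kT smp _ mono.
    by rewrite divr_gt0.
  by move=> j; exact: sqrtr_ge0.
set n : R := N%:R in n0 hN1 hN2 *.
have kn : L * k <= 256 * n.
  have hL : L * (k / 64) <= L * (d * S) by rewrite ler_pM2l.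
  by move: hN1; rewrite ler_norml => /andP[_ ?]; lra.
have -> : 2 / (d * L) - n^-1 * S = - ((d * L * S - 2 * n) / (d * L * n)).
  by field; rewrite !gt_eqF.
have p0 : 0 < d * L * n by rewrite !mulr_gt0.
rewrite normrN normrM normfV (gtr0_norm p0) ler_pdivrMr//.
apply: le_trans hN2 _.
rewrite (_ : eps * d * L ^+ 2 / 256 * k = eps * d * L / 256 * (L * k)); last by field.
apply: le_trans (ler_wpM2l _ kn) _; first by rewrite ltW// divr_gt0// !mulr_gt0.
by rewrite le_eqVlt; apply/orP; left; apply/eqP; field.
Qed.
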